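(* Let $k$ be an algebraically closed field of characteristic $p>0$ and let $V$ be the standard representation of $\mathrm{GL}(n)$ over $k$. (i) When $n=2$, as $\mathrm{GL}(2)$-representations, $$\mathrm T^\ell(V)=\begin{cases}\mathrm{Sym}^\ell(V)&\text{when }\ell<p,\\ \mathrm{Sym}^{2(p-1)-\ell}(V)\otimes\det(V)^{\ell-(p-1)}&\text{when }\ell\ge p.\end{cases}$$ (ii) Let $\ell(p)\ge0$ be the unique integer such that $0\le\ell-\ell(p)\cdot p<p$. Then, in the category of $\mathrm{GL}(n)$-representations, there is an exact sequence $$\begin{aligned}0&\to\mathrm{Sym}^{\ell-\ell(p)p}(V)\otimes_k\textstyle\bigwedge^{\ell(p)}(F^*V)\xrightarrow{\phi}\mathrm{Sym}^{\ell-(\ell(p)-1)p}(V)\otimes_k\bigwedge^{\ell(p)-1}(F^*V)\to\cdots\\&\to\mathrm{Sym}^{\ell-qp}(V)\otimes_k\textstyle\bigwedge^{q}(F^*V)\xrightarrow{\phi}\mathrm{Sym}^{\ell-(q-1)p}(V)\otimes_k\bigwedge^{q-1}(F^*V)\to\cdots\\&\to\mathrm{Sym}^{\ell-p}(V)\otimes_kF^*V\xrightarrow{\phi}\mathrm{Sym}^\ell(V)\to\mathrm T^\ell(V)\to0.\end{aligned}$$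
   Context: Let $e_1,\dots,e_n$ be a basis of $V$. The symmetric group $\mathrm S_\ell$ acts on $V^{\otimes\ell}$ by $(v_1\otimes\cdots\otimes v_\ell)\cdot\sigma=v_{\sigma(1)}\otimes\cdots\otimes v_{\sigma(\ell)}$. For $k_i\ge0$ with $k_1+\cdots+k_n=\ell$ put $v(k_1,\dots,k_n)=\sum_{\sigma\in\mathrm S_\ell}(e_1^{\otimes k_1}\otimes\cdots\otimes e_n^{\otimes k_n})\cdot\sigma$. $\mathrm T^\ell(V)\subset V^{\otimes\ell}$ is the linear subspace spanned by all $v(k_1,\dots,k_n)$; it is a $\mathrm{GL}(n)$-subrepresentation. It vanishes for $\ell>n(p-1)$, and $\mathrm{Sym}^j(V)=0$ for $j<0$. $F^*V$ is the Frobenius twist of $V$, i.e. $V$ with $\mathrm{GL}(n)$ acting through the homomorphism $\mathrm{GL}(n)\to\mathrm{GL}(n)$, $(a_{ij})\mapsto(a_{ij}^p)$. The map $\mathrm{Sym}^\ell(V)\to\mathrm T^\ell(V)$ sends $e_1^{k_1}\cdots e_n^{k_n}$ to $v(k_1,\dots,k_n)$. The $k$-linear map $\phi:\mathrm{Sym}^{\ell-qp}(V)\otimes\bigwedge^q(F^*V)\to\mathrm{Sym}^{\ell-(q-1)p}(V)\otimes\bigwedge^{q-1}(F^*V)$ is defined, for $f\in\mathrm{Sym}^{\ell-qp}(V)$ and $k_1<\cdots<k_q$, by $$\phi(f\otimes e_{k_1}\wedge\cdots\wedge e_{k_q})=\sum_{i=1}^q(-1)^{i-1}e_{k_i}^pf\otimes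 e_{k_1}\wedge\cdots\wedge\hat e_{k_i}\wedge\cdots\wedge e_{k_q}.$$ *)

(* Defs.v *)
From HB Require Import structures.
From mathcomp Require Import all_boot all_order all_algebra all_fingroup.
From mathcomp.multinomials Require Import mpoly.

Set Implicit Arguments.
Unset Strict Implicit.
Unset Printing Implicit Defensive.

Import GRing.Theory.
Local Open Scope ring_scope.

Section Regular.
Variables (k : fieldType) (n : nat).

(* The coordinate ring k[GL(n)] = k[x_ij, 1/det], as functions on 'M_n of
   which only the values on invertible matrices are relevant. *)
Inductive regular : ('M[k]_n -> k) -> Prop :=
| regular_const c : regular (fun=> c)
| regular_entry i j : regular (fun g => g i j)
| regular_invdet : regular (fun g => (\det g)^-1)
| regular_add a b : regular a -> regular b -> regular (fun g => a g + b g)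
| regular_mul a b : regular a -> regular b -> regular (fun g => a g * b g)
| regular_ext a b : regular a -> {in unitmx, a =1 b} -> regular b.

Lemma regular_eq a b : regular a -> a =1 b -> regular b.
Proof. by move=> ra ab; apply: (regular_ext ra) => g _; apply: ab. Qed.

Lemma regular_sum (I : Type) (r : seq I) (P : pred I) (F : I -> 'M[k]_n -> k) :
  (forall i, P i -> regular (F i)) ->
  regular (fun g => \sum_(i <- r | P i) F i g).
Proof.
move=> rF; elim: r => [|i r IHr].
  by apply: (regular_eq (regular_const 0)) => g; rewrite big_nil.
case Pi: (P i).
  apply: (regular_eq (regular_add (rF i Pi) IHr)) => g.
  by rewrite big_cons Pi.
by apply: (regular_eq IHr) => g; rewrite big_cons Pi.
Qed.

Lemma regular_prod (I : Type) (r : seq I) (P : pred I) (F : I -> 'M[k]_n -> k) :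
  (forall i, P i -> regular (F i)) ->
  regular (fun g => \prod_(i <- r | P i) F i g).
Proof.
move=> rF; elim: r => [|i r IHr].
  by apply: (regular_eq (regular_const 1)) => g; rewrite big_nil.
case Pi: (P i).
  apply: (regular_eq (regular_mul (rF i Pi) IHr)) => g.
  by rewrite big_cons Pi.
by apply: (regular_eq IHr) => g; rewrite big_cons Pi.
Qed.

Lemma regular_exp a d : regular a -> regular (fun g => a g ^+ d).
Proof.
move=> ra; elim: d => [|d IHd].
  by apply: (regular_eq (regular_const 1)) => g; rewrite expr0.
by apply: (regular_eq (regular_mul ra IHd)) => g; rewrite exprS.
Qed.

Lemma regular_det m (F : 'M[k]_n -> 'M[k]_m) :
  (forall i j, regular (fun g => F g i j)) -> regular (fun g => \det (F g)).
Proof.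
move=> rF; apply: regular_sum => s _; apply: regular_mul.
  exact: regular_const.
exact: regular_prod.
Qed.

End Regular.

Section LinearExtras.
Variable k : fieldType.

Lemma linfunE (U W : vectType k) (f : U -> W) :
  linear f -> forall u, linfun f u = f u.
Proof.
move=> lf u.
pose fl := GRing.isLinear.Build k U W _ f lf.
pose fL : {linear U -> W} := HB.pack f fl.
exact: (lfunE fL).
Qed.

Lemma linear_sumZ (U W : vectType k) (f : U -> W) (I : Type) (r : seq I)
    (P : pred I) (c : I -> k) (u : I -> U) : linear f ->
  f (\sum_(i <- r | P i) c i *: u i) = \sum_(i <- r | P i) c i *: f (u i).
Proof.
move=> lf; rewrite -(linfunE lf) linear_sum; apply: eq_bigr => i _.
by rewrite linearZ /= linfunE.
Qed.

End LinearExtras.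

Section Representations.
Variable k : fieldType.

(* Finite dimensional rational representations of GL(n) over k. The action is
   indexed by all of 'M_n, but only its values on invertible matrices matter. *)
Record rep (n : nat) := Rep {
  rep_sort :> vectType k;
  act : 'M[k]_n -> 'End(rep_sort);
  act1 : act 1%:M = \1%VF;
  actM : {in unitmx &, forall g h, act (g *m h) = (act g \o act h)%VF};
  act_regular : forall (phi : 'Hom(rep_sort, k^o)) (u : rep_sort),
    regular (fun g => phi (act g u)) }.

Definition equivariant n (U W : rep n) (f : 'Hom(U, W)) : Prop :=
  forall g : 'M[k]_n, g \in unitmx -> (f \o act U g = act W g \o f)%VF.

Definition rep_iso n (U W : rep n) : Prop :=
  exists f : 'Hom(U, W), [/\ equivariant f, lker f = 0%VS & limg f = fullv].

Lemma regular_expand n (U : vectType k) (I : finType) (P : pred I)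
    (F : 'M[k]_n -> U) (c : I -> 'M[k]_n -> k) (b : I -> U) :
    (forall i, P i -> regular (c i)) ->
    (forall g, F g = \sum_(i | P i) c i g *: b i) ->
  forall phi : 'Hom(U, k^o), regular (fun g => phi (F g)).
Proof.
move=> rc FE phi.
have r1 : regular (fun g => \sum_(i | P i) c i g * phi (b i)).
  by apply: regular_sum => i Pi; apply: regular_mul; [exact: rc|exact: regular_const].
apply: (regular_eq r1) => g; rewrite FE linear_sum; apply: eq_bigr => i _.
by rewrite linearZ.
Qed.

(* Representations with underlying space k^m, i.e. rational homomorphisms
   GL(n) -> GL(m). *)
Record mxrep (n m : nat) := MxRep {
  mxact :> 'M[k]_n -> 'M[k]_m;
  mxact1 : mxact 1%:M = 1%:M;
  mxactM : {in unitmx &, forall g h, mxact (g *m h) = mxact g *m mxact h};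
  mxact_regular : forall i j, regular (fun g => mxact g i j) }.

Section Sub.
Variables (n : nat) (U : rep n) (X : {vspace U}).
Hypothesis stabX : forall g u, u \in X -> act U g u \in X.

Definition sub_act (g : 'M[k]_n) : 'End(subvs_of X) :=
  linfun (fun x => vsproj X (act U g (vsval x))).

Lemma sub_act_linear g : linear (fun x : subvs_of X => vsproj X (act U g (vsval x))).
Proof. by move=> c x y; rewrite !linearP. Qed.

Lemma sub_actE g x : vsval (sub_act g x) = act U g (vsval x).
Proof. by rewrite linfunE ?vsprojK ?stabX ?subvsP //; apply: sub_act_linear. Qed.

Lemma sub_act1 : sub_act 1%:M = \1%VF.
Proof.
apply/lfunP=> x; apply: val_inj.
by rewrite -[LHS]/(vsval _) sub_actE act1 !lfunE.
Qed.

Lemma sub_actM :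
  {in unitmx &, forall g h, sub_act (g *m h) = (sub_act g \o sub_act h)%VF}.
Proof.
move=> g h gu hu; apply/lfunP=> x; apply: val_inj.
by rewrite lfunE /= -[LHS]/(vsval _) -[RHS]/(vsval _) !sub_actE actM // lfunE.
Qed.

Lemma sub_act_regular (phi : 'Hom(subvs_of X, k^o)) x :
  regular (fun g => phi (sub_act g x)).
Proof.
have lp : linear (vsproj X) by move=> c u v; rewrite linearP.
apply: (regular_eq (act_regular (phi \o linfun (vsproj X))%VF (vsval x))) => g.
by rewrite lfunE /= (linfunE lp) [in RHS]linfunE //; apply: sub_act_linear.
Qed.

Definition sub_rep : rep n := Rep sub_act1 sub_actM sub_act_regular.
End Sub.

Section Tensor.

(* U (x) W, with u (x) w represented by the matrix of the products of the
   coordinates of u and w. *)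
Definition tens_sp (U W : vectType k) : vectType k :=
  'M[k]_(\dim {:U}, \dim {:W}).

Definition tens (U W : vectType k) (u : U) (w : W) : tens_sp U W :=
  \matrix_(i, j) (coord (vbasis {:U}) i u * coord (vbasis {:W}) j w).

(* The linear map U (x) W -> Z induced by a bilinear map b : U x W -> Z. *)
Definition tens_lift (U W Z : vectType k) (b : U -> W -> Z) :
    'Hom(tens_sp U W, Z) :=
  linfun (fun t : 'M[k]_(\dim {:U}, \dim {:W}) =>
    \sum_i \sum_j t i j *: b (vbasis {:U})`_i (vbasis {:W})`_j).

Lemma tens_lift_linear (U W Z : vectType k) (b : U -> W -> Z) :
  linear (fun t : 'M[k]_(\dim {:U}, \dim {:W}) =>
    \sum_i \sum_j t i j *: b (vbasis {:U})`_i (vbasis {:W})`_j).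
Proof.
move=> c s t; rewrite scaler_sumr -big_split; apply: eq_bigr => i _ /=.
rewrite scaler_sumr -big_split; apply: eq_bigr => j _ /=.
by rewrite !mxE scalerDl scalerA.
Qed.

Lemma tens_lift_coordE (U W Z : vectType k) (b : U -> W -> Z) (t : tens_sp U W) :
  tens_lift b t = \sum_i \sum_j t i j *: b (vbasis {:U})`_i (vbasis {:W})`_j.
Proof. by rewrite linfunE //; apply: tens_lift_linear. Qed.

Lemma vbasis_expand (U : vectType k) (u : U) :
  u = \sum_i coord (vbasis {:U}) i u *: (vbasis {:U})`_i.
Proof. exact/coord_vbasis/memvf. Qed.

Lemma coord_vbasisf (U : vectType k) (i j : 'I_(\dim {:U})) :
  coord (vbasis {:U}) i (vbasis {:U})`_j = (i == j)%:R.
Proof. by rewrite coord_free ?(basis_free (vbasisP _)) // eq_sym. Qed.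

Lemma tens_liftE (U W Z : vectType k) (b : U -> W -> Z) u w :
  (forall u, linear (b u)) -> (forall w, linear (b^~ w)) ->
  tens_lift b (tens u w) = b u w.
Proof.
move=> lr ll; rewrite tens_lift_coordE.
rewrite [in RHS](vbasis_expand u) (linear_sumZ _ _ _ _ (ll w)).
apply: eq_bigr => i _.
rewrite [in RHS](vbasis_expand w) (linear_sumZ _ _ _ _ (lr _)).
by rewrite scaler_sumr; apply: eq_bigr => j _; rewrite scalerA mxE.
Qed.

Lemma tensr_linear (U W : vectType k) (u : U) : linear (fun w : W => tens u w).
Proof.
move=> c x y; apply/matrixP=> i j.
by rewrite !mxE linearP mulrDr mulrCA.
Qed.

Lemma tensl_linear (U W : vectType k) (w : W) : linear (fun u : U => tens u w).
Proof.
move=> c x y; apply/matrixP=> i j.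
by rewrite !mxE linearP mulrDl mulrA.
Qed.

Lemma tens_delta (U W : vectType k) (i : 'I_(\dim {:U})) (j : 'I_(\dim {:W})) :
  tens (vbasis {:U})`_i (vbasis {:W})`_j = delta_mx i j.
Proof. by apply/matrixP=> a b; rewrite !mxE !coord_vbasisf -natrM mulnb. Qed.

Lemma eq_tens (U W Z : vectType k) (f f' : 'Hom(tens_sp U W, Z)) :
  (forall u w, f (tens u w) = f' (tens u w)) -> f = f'.
Proof.
move=> ff; apply/lfunP=> t; rewrite (matrix_sum_delta t) !linear_sum.
apply: eq_bigr => i _; rewrite !linear_sum; apply: eq_bigr => j _.
by rewrite !linearZ /= -tens_delta ff.
Qed.

Definition tens_hom (U U' W W' : vectType k) (f : 'Hom(U, U')) (h : 'Hom(W, W')) :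
    'Hom(tens_sp U W, tens_sp U' W') :=
  tens_lift (fun u w => tens (f u) (h w)).

Lemma tens_homE (U U' W W' : vectType k) (f : 'Hom(U, U')) (h : 'Hom(W, W')) u w :
  tens_hom f h (tens u w) = tens (f u) (h w).
Proof.
apply: tens_liftE => [a|a] c x y; rewrite linearP; first exact: tensr_linear.
exact: tensl_linear.
Qed.

Variables (n : nat) (U W : rep n).
Definition tens_act (g : 'M[k]_n) : 'End(tens_sp U W) :=
  tens_hom (act U g) (act W g).

Lemma tens_act1 : tens_act 1%:M = \1%VF.
Proof. by apply: eq_tens => u w; rewrite tens_homE !act1 !id_lfunE. Qed.

Lemma tens_actM :
  {in unitmx &, forall g h, tens_act (g *m h) = (tens_act g \o tens_act h)%VF}.
Proof.
move=> g h gu hu; apply: eq_tens => u w.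
by rewrite lfunE /= !tens_homE !actM // !lfunE.
Qed.

Lemma tens_act_regular (phi : 'Hom(tens_sp U W, k^o)) t :
  regular (fun g => phi (tens_act g t)).
Proof.
pose cd (Z : vectType k) a (z : Z) : k^o := coord (vbasis {:Z}) a z.
have lc (Z : vectType k) a : linear (@cd Z a).
  by move=> c x y; rewrite /cd linearP.
pose e (Z : vectType k) (a : 'I_(\dim {:Z})) : Z := (vbasis {:Z})`_a.
pose I := ('I_(\dim {:U}) * 'I_(\dim {:W}))%type.
pose c (ab : I) (g : 'M[k]_n) : k := \sum_i \sum_j
   t i j * (cd _ ab.1 (act U g (e _ i)) * cd _ ab.2 (act W g (e _ j))).
apply: (@regular_expand _ _ I predT _ c (fun ab => delta_mx ab.1 ab.2)) => [ab _|g].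
  apply: regular_sum => i _; apply: regular_sum => j _.
  apply: regular_mul; first exact: regular_const.
  apply: regular_mul.
    apply: (regular_eq (act_regular (linfun (@cd U ab.1)) (e U i))).
    by move=> g; rewrite linfunE.
  apply: (regular_eq (act_regular (linfun (@cd W ab.2)) (e W j))).
  by move=> g; rewrite linfunE.
rewrite /tens_act /tens_hom tens_lift_coordE.
rewrite [LHS]matrix_sum_delta pair_big /=; apply: eq_bigr => -[a b] _ /=.
congr (_ *: _); rewrite summxE /c; apply: eq_bigr => i _.
by rewrite summxE; apply: eq_bigr => j _; rewrite !mxE.
Qed.

Definition tens_rep : rep n := Rep tens_act1 tens_actM tens_act_regular.
End Tensor.

Section Std.
Variable n : nat.

Lemma std_regular i j : regular (fun g : 'M[k]_n => (id g) i j).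
Proof. exact: regular_entry. Qed.

Definition std : mxrep n n :=
  @MxRep n n id erefl (fun _ _ _ _ => erefl) std_regular.

(* m = 0 : the zero representation *)
Definition zero_mxrep : mxrep n 0.
Proof.
by exists (fun=> 0) => [|g h _ _|[]//]; apply/matrixP=> -[].
Defined.

Lemma det_act1 d : (\det (1%:M : 'M[k]_n) ^+ d)%:M = 1%:M :> 'M_1.
Proof. by rewrite det1 expr1n. Qed.

Lemma det_actM d : {in unitmx &, forall g h : 'M[k]_n,
  (\det (g *m h) ^+ d)%:M = (\det g ^+ d)%:M *m (\det h ^+ d)%:M :> 'M_1}.
Proof. by move=> g h _ _; rewrite det_mulmx exprMn scalar_mxM. Qed.

Lemma det_regular d (i j : 'I_1) :
  regular (fun g : 'M[k]_n => (\det g ^+ d)%:M i j).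
Proof.
apply: (regular_eq (regular_exp d (regular_det (@regular_entry k n)))) => g.
by rewrite !ord1 mxE mulr1n.
Qed.

(* det(V)^d *)
Definition det_mxrep d : mxrep n 1 :=
  @MxRep n 1 (fun g => (\det g ^+ d)%:M) (det_act1 d) (@det_actM d)
    (@det_regular d).

Variables (p : nat) (charkp : p \in [pchar k]).

Definition frob_mx (g : 'M[k]_n) : 'M[k]_n := \matrix_(i, j) g i j ^+ p.

Lemma frob_mxE g : frob_mx g = map_mx (pFrobenius_aut charkp) g.
Proof. by apply/matrixP=> i j; rewrite !mxE pFrobenius_autE. Qed.

Lemma frob_mx1 : frob_mx 1%:M = 1%:M.
Proof. by rewrite frob_mxE map_mx1. Qed.

Lemma frob_mxM : {in unitmx &, forall g h,
  frob_mx (g *m h) = frob_mx g *m frob_mx h}.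
Proof. by move=> g h _ _; rewrite !frob_mxE map_mxM. Qed.

Lemma frob_regular i j : regular (fun g => frob_mx g i j).
Proof.
apply: (regular_eq (regular_exp p (regular_entry k i j))) => g.
by rewrite mxE.
Qed.

(* F^* V *)
Definition frob_std : mxrep n n := MxRep frob_mx1 frob_mxM frob_regular.
End Std.

Section Col.
Variables (n m : nat) (W : mxrep n m).

Definition col_act (g : 'M[k]_n) : 'End('cV[k]_m) := linfun (mulmx (W g)).

Lemma col_act1 : col_act 1%:M = \1%VF.
Proof. by apply/lfunP=> x; rewrite !lfunE /= mxact1 mul1mx. Qed.

Lemma col_actM :
  {in unitmx &, forall g h, col_act (g *m h) = (col_act g \o col_act h)%VF}.
Proof.
by move=> g h gu hu; apply/lfunP=> x; rewrite !lfunE /= !lfunE /= mxactM // mulmxA.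
Qed.

Lemma col_act_regular (phi : 'Hom('cV[k]_m, k^o)) x :
  regular (fun g => phi (col_act g x)).
Proof.
apply: (@regular_expand _ _ _ predT _ (fun i g => \sum_j W g i j * x j 0)
  (fun i => delta_mx i 0)) => [i _|g].
  apply: regular_sum => j _; apply: regular_mul; first exact: mxact_regular.
  exact: regular_const.
rewrite lfunE /= [LHS]matrix_sum_delta; apply: eq_bigr => i _.
by rewrite big_ord1 mxE.
Qed.

Definition col_rep : rep n := Rep col_act1 col_actM col_act_regular.
End Col.

Section FfunSpaces.
Variable I : finType.

Definition ffdelta (i : I) : {ffun I -> k^o} := [ffun j => (j == i)%:R].

Lemma ffun_sum_delta (x : {ffun I -> k^o}) : x = \sum_i x i *: ffdelta i.
Proof.
apply/ffunP=> j; rewrite sum_ffunE (bigD1 j) //= big1 => [|i ij].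
  by rewrite !ffunE eqxx addr0 [RHS]mulr1.
by rewrite !ffunE eq_sym (negPf ij) [LHS]mulr0.
Qed.

Lemma ffun_comb_linear (Z : vectType k) (b : I -> Z) :
  linear (fun x : {ffun I -> k^o} => \sum_i x i *: b i).
Proof.
move=> c x y; rewrite scaler_sumr -big_split; apply: eq_bigr => i _ /=.
by rewrite !ffunE scalerDl scalerA.
Qed.
End FfunSpaces.

Section TensorPower.
Variables (l m : nat).

(* (k^m)^{(x) l} : the coordinate at w is that of e_(w 0) (x) ... (x) e_(w (l-1)). *)
Definition tpow : vectType k := {ffun {ffun 'I_l -> 'I_m} -> k^o}.

Definition tprod (v : 'I_l -> 'cV[k]_m) : tpow :=
  [ffun w : {ffun 'I_l -> 'I_m} => \prod_i v i (w i) 0].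

(* The right action of S_l; see tpow_perm_tprod. *)
Definition tpow_perm (s : 'S_l) (t : tpow) : tpow :=
  [ffun w : {ffun 'I_l -> 'I_m} => t [ffun i => w ((s^-1)%g i)]].

Lemma tpow_perm_tprod s v : tpow_perm s (tprod v) = tprod (fun i => v (s i)).
Proof.
apply/ffunP=> w; rewrite !ffunE (reindex_inj (@perm_inj _ s)).
by apply: eq_bigr => i _; rewrite ffunE permK.
Qed.

Definition std_basis (i : 'I_m) : 'cV[k]_m := delta_mx i 0.

Definition tbasis (w : {ffun 'I_l -> 'I_m}) : tpow := tprod (fun i => std_basis (w i)).

Lemma tbasisE w : tbasis w = ffdelta w.
Proof.
apply/ffunP=> u; rewrite !ffunE; have [->|uw] := eqVneq u w.
  by rewrite big1 // => i _; rewrite mxE !eqxx.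
have [i ui] : exists i, u i != w i.
  apply/existsP; apply: contraNT uw => /existsPn eq_uw.
  by apply/eqP/ffunP=> i; apply/eqP/negPn/eq_uw.
by rewrite (bigD1 i) //= mxE (negPf ui) mul0r.
Qed.

Section Act.
Variables (n : nat) (W : mxrep n m).

Definition tpow_act (g : 'M[k]_n) : 'End(tpow) :=
  linfun (fun t : {ffun {ffun 'I_l -> 'I_m} -> k^o} =>
    \sum_w t w *: tprod (fun i => W g *m std_basis (w i))).

Lemma tpow_act_expand g (t : tpow) :
  tpow_act g t = \sum_w t w *: tprod (fun i => W g *m std_basis (w i)).
Proof. by rewrite linfunE //; apply: ffun_comb_linear. Qed.

Lemma mulmx_std_basis (A : 'M[k]_m) i j : (A *m std_basis j) i 0 = A i j.
Proof. by rewrite -colE mxE. Qed.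

Lemma tpow_act_tprod g v :
  tpow_act g (tprod v) = tprod (fun i => W g *m v i).
Proof.
rewrite tpow_act_expand; apply/ffunP=> u; rewrite sum_ffunE ffunE.
transitivity (\prod_i \sum_j v i j 0 * W g (u i) j); last first.
  by apply: eq_bigr => i _; rewrite mxE; apply: eq_bigr => j _; rewrite mulrC.
rewrite bigA_distr_bigA; apply: eq_bigr => w _; rewrite !ffunE.
rewrite [LHS]/GRing.scale /= -big_split.
by apply: eq_bigr => i _; rewrite mulmx_std_basis.
Qed.

Lemma eq_tpow (Z : vectType k) (f f' : 'Hom(tpow, Z)) :
  (forall w, f (tbasis w) = f' (tbasis w)) -> f = f'.
Proof.
move=> ff; apply/lfunP=> t; rewrite (ffun_sum_delta t) !linear_sum.
by apply: eq_bigr => w _; rewrite !linearZ /= -tbasisE ff.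
Qed.

Lemma tpow_act1 : tpow_act 1%:M = \1%VF.
Proof.
apply: eq_tpow => w; rewrite tpow_act_tprod id_lfunE.
by apply/ffunP=> u; rewrite !ffunE; apply: eq_bigr => i _; rewrite mxact1 mul1mx.
Qed.

Lemma tpow_actM :
  {in unitmx &, forall g h, tpow_act (g *m h) = (tpow_act g \o tpow_act h)%VF}.
Proof.
move=> g h gu hu; apply: eq_tpow => w; rewrite comp_lfunE !tpow_act_tprod.
by apply/ffunP=> u; rewrite !ffunE; apply: eq_bigr => i _; rewrite mxactM // mulmxA.
Qed.

Lemma tpow_act_regular (phi : 'Hom(tpow, k^o)) t :
  regular (fun g => phi (tpow_act g t)).
Proof.
apply: (@regular_expand n tpow {ffun 'I_l -> 'I_m} predT (fun g => tpow_act g t)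
  (fun u g => \sum_(w : {ffun 'I_l -> 'I_m})
     (t : {ffun {ffun 'I_l -> 'I_m} -> k^o}) w * \prod_i W g (u i) (w i))
  (@ffdelta _)) => [u _|g].
  apply: regular_sum => w _; apply: regular_mul; first exact: regular_const.
  by apply: regular_prod => i _; apply: mxact_regular.
rewrite [LHS]ffun_sum_delta; apply: eq_bigr => u _; congr (_ *: _).
rewrite tpow_act_expand sum_ffunE; apply: eq_bigr => w _.
rewrite !ffunE; congr (_ * _); apply: eq_bigr => i _.
by rewrite mulmx_std_basis.
Qed.

Definition tpow_rep : rep n := Rep tpow_act1 tpow_actM tpow_act_regular.
End Act.

(* e_1^{(x) a_1} (x) ... (x) e_m^{(x) a_m}, for mdeg a = l *)
Definition monomial_tensor (a : 'X_{1..m}) : tpow :=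
  tprod (fun i => nth 0 (flatten [seq nseq (a j) (std_basis j) | j <- enum 'I_m]) i).

(* v(a_1, ..., a_m) *)
Definition vsym (a : 'X_{1..m}) : tpow :=
  \sum_(s : 'S_l) tpow_perm s (monomial_tensor a).

Definition Tspace : {vspace tpow} :=
  <<[seq vsym a | a : 'X_{1..m < l.+1} in [pred a | mdeg (val a) == l]]>>%VS.

Lemma vsym_T (a : 'X_{1..m}) : mdeg a = l -> vsym a \in Tspace.
Proof.
move=> al; have lt_a : (mdeg a < l.+1)%N by rewrite al.
by apply/memv_span/imageP; exists (BMultinom lt_a); rewrite //= inE /= al.
Qed.

Lemma sum_count_mem (T : finType) (P : pred T) (s : seq T) :
  (\sum_(j | P j) count_mem j s)%N = count P s.
Proof.
elim: s => [|x s IHs] /=; first by rewrite big1.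
rewrite big_split IHs /=; congr (_ + _)%N.
rewrite big_mkcond (bigD1 x) //= eqxx big1 => [|j jx]; first by case: (P x).
by rewrite eq_sym (negPf jx); case: (P j).
Qed.

Lemma monomial_tensor_word (a : 'X_{1..m}) (w : {ffun 'I_l -> 'I_m}) :
  (forall j, a j = count_mem j (codom w)) ->
  exists s : 'S_l, monomial_tensor a = tpow_perm s (tbasis w).
Proof.
move=> aw; pose wd := flatten [seq nseq (a j) j | j <- enum 'I_m].
have perm_wd : perm_eq wd [tuple w i | i < l].
  have -> : [tuple w i | i < l] = codom w :> seq _ by rewrite /= codomE enumT.
  apply/seq.permP => P; rewrite -[RHS]sum_count_mem count_flatten -map_comp sumnE.
  rewrite big_map big_enum [RHS]big_mkcond /=; apply: eq_big => // j _.
  by rewrite /= count_nseq aw; case: (P j); rewrite ?mul1n.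
have [s wds] := tuple_permP perm_wd.
exists s; rewrite /tbasis tpow_perm_tprod; apply/ffunP=> u; rewrite !ffunE.
apply: eq_bigr => i _; congr (fun_of_matrix _ _ _).
have -> : flatten [seq nseq (a j) (std_basis j) | j <- enum 'I_m]
    = [seq std_basis j | j <- wd].
  by rewrite /wd map_flatten -map_comp; congr flatten; apply: eq_map => j /=; rewrite map_nseq.
have sz : size wd = l by rewrite wds size_tuple.
rewrite (nth_map (w i)) ?sz // wds -tnth_nth !tnth_mktuple.
by [].
Qed.

Lemma sum_perm_tbasis (w : {ffun 'I_l -> 'I_m}) :
  \sum_(s : 'S_l) tpow_perm s (tbasis w) \in Tspace.
Proof.
pose a : 'X_{1..m} := [multinom count_mem j (codom w) | j < m].
have aw j : a j = count_mem j (codom w) by rewrite mnmE.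
have al : mdeg a = l.
  rewrite mdegE (eq_bigr _ (fun j _ => aw j)).
  by rewrite sum_count_mem count_predT size_codom card_ord.
have [s0 s0E] := monomial_tensor_word aw.
suff <- : vsym a = \sum_(s : 'S_l) tpow_perm s (tbasis w) by apply: vsym_T.
rewrite /vsym s0E [RHS](reindex_inj (mulIg s0)) /=; apply: eq_bigr => s _.
rewrite /tbasis !tpow_perm_tprod; apply/ffunP=> u; rewrite !ffunE.
by apply: eq_bigr => i _; rewrite permM.
Qed.

End TensorPower.

Section TRep.
Variables (l n m : nat) (W : mxrep n m).

Lemma tpow_perm_linear (s : 'S_l) : linear (@tpow_perm l m s).
Proof. by move=> c x y; apply/ffunP=> w; rewrite !ffunE. Qed.

Lemma T_stable g u : u \in Tspace l m -> act (tpow_rep l W) g u \in Tspace l m.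
Proof.
suff: (Tspace l m <= act (tpow_rep l W) g @^-1: Tspace l m)%VS.
  by move=> /subvP sT uT; rewrite memv_preim sT.
apply/span_subvP=> _ /imageP [a _ ->]; rewrite -memv_preim.
rewrite linear_sum /= /monomial_tensor.
set v := (X in tprod X); pose t : tpow l m := tprod (fun i => W g *m v i).
have E s : tpow_act l W g (tpow_perm s (tprod v)) = tpow_perm s t.
  by rewrite /t !tpow_perm_tprod tpow_act_tprod.
rewrite (eq_bigr _ (fun s _ => E s)).
have tE s : tpow_perm s t = \sum_w t w *: tpow_perm s (tbasis w).
  rewrite {1}(ffun_sum_delta t) (linear_sumZ _ _ _ _ (tpow_perm_linear s)).
  by apply: eq_bigr => w _; rewrite tbasisE.
rewrite (eq_bigr _ (fun s _ => tE s)) exchange_big rpred_sum // => w _ /=.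
by rewrite -scaler_sumr rpredZ // sum_perm_tbasis.
Qed.

Definition T_rep : rep n := @sub_rep n (tpow_rep l W) (Tspace l m) T_stable.
End TRep.

Section SymSpace.
Variables m d : nat.

(* Sym^d(k^m). This duplicates dhomog, which is a vectType only for m > 0. *)
Record sympow :=
  SymPow { sympoly :> {mpoly k[m]}; sympow_homog : sympoly \is d.-homog }.

HB.instance Definition _ := [isSub for sympoly].
HB.instance Definition _ := [Choice of sympow by <:].
HB.instance Definition _ := [SubChoice_isSubLmodule of sympow by <:].

Let I : finType := {a : 'X_{1..m < d.+1} | mdeg (val a) == d}.

Definition monom (a : I) : sympow :=
  SymPow (etrans (dhomogX k mdeg d (val (val a))) (valP a)).

Lemma mcoeff_sym_sum (c : I -> k) (f : I -> sympow) a :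
  (\sum_i c i *: f i : sympow)@_a = \sum_i c i * (f i)@_a.
Proof.
elim: (index_enum I) => [|i r IHr]; first by rewrite !big_nil mcoeff0.
by rewrite !big_cons mcoeffD mcoeffZ IHr.
Qed.

Lemma sympow_inj (f h : sympow) : (forall a : I, f@_(val (val a)) = h@_(val (val a))) -> f = h.
Proof.
move=> fh; apply/val_inj/mpolyP=> a.
have [ad|ad] := eqVneq (mdeg a) d; last first.
  by rewrite !(dhomog_nemf_coeff _ ad) //; apply: sympow_homog.
have lt_a : (mdeg a < d.+1)%N by rewrite ad.
have aI : mdeg (val (BMultinom lt_a)) == d by rewrite /= ad.
exact: (fh (exist _ (BMultinom lt_a) aI)).
Qed.

Lemma mcoeff_monom (a b : I) : (monom a)@_(val (val b)) = (a == b)%:R.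
Proof. by rewrite mcoeffX !(inj_eq val_inj). Qed.

Lemma sympow_expand (f : sympow) : f = \sum_(a : I) f@_(val (val a)) *: monom a.
Proof.
apply: sympow_inj => b; rewrite mcoeff_sym_sum (bigD1 b) //= big1 => [|a ab].
  by rewrite mcoeff_monom eqxx mulr1 addr0.
by rewrite mcoeff_monom (negPf ab) mulr0.
Qed.

Lemma sympow_vecaxiom : Vector.axiom #|I| (sympow).
Proof.
exists (fun f : sympow => \row_i f@_(val (val (enum_val i)))).
  move=> c f h; apply/rowP=> i; rewrite !mxE.
  by rewrite -[sympoly _]/(c *: (f : {mpoly k[m]}) + h) mcoeffD mcoeffZ.
exists (fun r : 'rV_#|I| => \sum_(a : I) r 0 (enum_rank a) *: monom a) => [f|r].
  by rewrite [RHS]sympow_expand; apply: eq_bigr => a _; rewrite mxE enum_rankK.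
apply/rowP=> i; rewrite mxE mcoeff_sym_sum (bigD1 (enum_val i)) //=.
rewrite big1 => [|a ab]; first by rewrite mcoeff_monom eqxx mulr1 addr0 enum_valK.
by rewrite mcoeff_monom (negPf ab) mulr0.
Qed.

HB.instance Definition _ :=
  Lmodule_hasFinDim.Build k (sympow) sympow_vecaxiom.

(* The degree d component of a polynomial. *)
Definition sym_proj (f : {mpoly k[m]}) : sympow :=
  SymPow (pihomogP mdeg d f).

Lemma sym_projE (f : {mpoly k[m]}) :
  f \is d.-homog -> (sym_proj f : {mpoly k[m]}) = f.
Proof. exact: pihomog_dE. Qed.

Lemma sym_projK (f : sympow) : sym_proj f = f.
Proof. apply: val_inj; exact/sym_projE/sympow_homog. Qed.

Lemma sym_proj_linear : linear sym_proj.
Proof. by move=> c f h; apply: val_inj; rewrite /= linearP. Qed.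

End SymSpace.

Section Sym.
Variables (d n m : nat) (W : mxrep n m).

(* e_j |-> \sum_i A_ij e_i *)
Definition lin_subst (A : 'M[k]_m) : m.-tuple {mpoly k[m]} :=
  [tuple \sum_i A i j *: 'X_i | j < m].

Definition sym_act (g : 'M[k]_n) : 'End(sympow m d) :=
  linfun (fun f : sympow m d => sym_proj d (f \mPo lin_subst (W g))).

Lemma lin_subst_homog A (f : {mpoly k[m]}) :
  f \is d.-homog -> f \mPo lin_subst A \is d.-homog.
Proof.
move=> fd; rewrite comp_mpolyE big_seq rpred_sum // => a af; apply: rpredZ.
have <- : mdeg a = d by apply: (dhomog_mf fd).
have hX j x : (tnth (lin_subst A) j) ^+ x \is x.-homog for mdeg.
  rewrite -[x in X in _ \is X]mul1n; apply: dhomogMn; rewrite tnth_mktuple.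
  by apply: rpred_sum => i _; apply: rpredZ; rewrite dhomogX; apply/eqP; exact: mdeg1.
rewrite mdegE; elim: (index_enum _) => [|j r IHr].
  by rewrite !big_nil dhomog1.
by rewrite !big_cons dhomogM.
Qed.

Lemma sym_actE g (f : sympow m d) :
  (sym_act g f : {mpoly k[m]}) = f \mPo lin_subst (W g).
Proof.
rewrite linfunE; first exact/sym_projE/lin_subst_homog/sympow_homog.
move=> c x y; rewrite -sym_proj_linear; congr sym_proj.
by rewrite -linearP.
Qed.

Lemma lin_subst1 (f : {mpoly k[m]}) : f \mPo lin_subst 1%:M = f.
Proof.
rewrite -[RHS]comp_mpoly_id; congr (_ \mPo _); apply: eq_from_tnth => j.
rewrite !tnth_mktuple (bigD1 j) //= big1 => [|i ij]; last first.
  by rewrite mxE (negPf ij) scale0r.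
by rewrite mxE eqxx scale1r addr0.
Qed.

Lemma lin_substM (A B : 'M[k]_m) (f : {mpoly k[m]}) :
  f \mPo lin_subst (A *m B) = (f \mPo lin_subst B) \mPo lin_subst A.
Proof.
rewrite [f]mpolyE [LHS]linear_sum [X in X \mPo _]linear_sum [RHS]linear_sum /=.
apply: eq_bigr => a _.
rewrite !linearZ /=; congr (_ *: _).
rewrite !comp_mpolyX rmorph_prod /=; apply: eq_bigr => j _.
rewrite rmorphXn /=; congr (_ ^+ _); rewrite !tnth_mktuple linear_sum /=.
under [RHS]eq_bigr => i _ do
  rewrite linearZ /= comp_mpolyXU -tnth_nth tnth_mktuple scaler_sumr.
rewrite exchange_big; apply: eq_bigr => i _ /=; rewrite mxE scaler_suml.
by apply: eq_bigr => h _; rewrite scalerA mulrC.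
Qed.

Lemma sym_act1 : sym_act 1%:M = \1%VF.
Proof.
by apply/lfunP=> f; apply: val_inj; rewrite [LHS]sym_actE mxact1 lin_subst1 id_lfunE.
Qed.

Lemma sym_actM :
  {in unitmx &, forall g h, sym_act (g *m h) = (sym_act g \o sym_act h)%VF}.
Proof.
move=> g h gu hu; apply/lfunP=> f; apply: val_inj.
by rewrite comp_lfunE [LHS]sym_actE [RHS]sym_actE sym_actE mxactM // lin_substM.
Qed.

Lemma regular_mcoeff_prod (I : finType) (F : I -> 'M[k]_n -> {mpoly k[m]}) (e : I -> nat) :
  (forall i a, regular (fun g => (F i g)@_a)) ->
  forall a, regular (fun g => (\prod_i F i g ^+ e i)@_a).
Proof.
move=> rF.
have r1 (a : 'X_{1..m}) : regular (fun _ : 'M[k]_n => (1 : {mpoly k[m]})@_a).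
  exact: regular_const.
have rM (P Q : 'M[k]_n -> {mpoly k[m]}) :
    (forall a, regular (fun g => (P g)@_a)) -> (forall a, regular (fun g => (Q g)@_a)) ->
    forall a, regular (fun g => (P g * Q g)@_a).
  move=> rP rQ a; apply: (@regular_eq _ _ (fun g =>
    \sum_(b : 'X_{1..m < (mdeg a).+1, (mdeg a).+1} | a == (b.1 + b.2)%MM)
       ((P g)@_b.1 * (Q g)@_b.2))) => [|g]; last by rewrite mcoeffM.
  by apply: regular_sum => b _; apply: regular_mul.
elim: (index_enum I) => [|i r IHr] a.
  by apply: (regular_eq (r1 a)) => g; rewrite big_nil.
suff rX: forall b, regular (fun g => (F i g ^+ e i)@_b).
  by apply: (regular_eq (rM _ _ rX IHr a)) => g; rewrite big_cons.
elim: (e i) => [|x IHx] b; first by apply: (regular_eq (r1 b)) => g; rewrite expr0.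
by apply: (regular_eq (rM _ _ (rF i) IHx b)) => g; rewrite exprS.
Qed.

Lemma sym_act_regular (phi : 'Hom(sympow m d, k^o)) f :
  regular (fun g => phi (sym_act g f)).
Proof.
apply: (@regular_expand _ _ _ predT _ (fun a g => (sym_act g f)@_(val (val a))) (@monom m d))
  => [a _|g]; last exact: sympow_expand.
apply: (@regular_eq _ _ (fun g => \sum_(b <- msupp (f : {mpoly k[m]})) f@_b *
   (\prod_(i < m) (tnth (lin_subst (W g)) i) ^+ (b i))@_(val (val a)))) => [|g].
  apply: regular_sum => b _; apply: regular_mul; first exact: regular_const.
  apply: regular_mcoeff_prod => j c.
  apply: (@regular_eq _ _ (fun g => \sum_i W g i j * ('X_i : {mpoly k[m]})@_c)) => [|g].
    apply: regular_sum => i _; apply: regular_mul; first exact: mxact_regular.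
    exact: regular_const.
  rewrite tnth_mktuple raddf_sum; apply: eq_bigr => i _; by rewrite /= mcoeffZ.
rewrite sym_actE comp_mpolyE raddf_sum; apply: eq_bigr => b _; by rewrite /= mcoeffZ.
Qed.

Definition sym_rep : rep n := Rep sym_act1 sym_actM sym_act_regular.
End Sym.

Section Incr.
Variables q m : nat.

(* Strictly increasing J : k_1 < ... < k_q, indexing the standard basis of the
   q-th exterior power. *)
Record incr := Incr {
  incr_fun :> {ffun 'I_q -> 'I_m};
  _ : [forall i : 'I_q, forall j : 'I_q, (i < j)%N ==> (incr_fun i < incr_fun j)%N] }.

HB.instance Definition _ := [isSub for incr_fun].
HB.instance Definition _ := [Finite of incr by <:].

Lemma incr_lt (J : incr) (i j : 'I_q) : (i < j)%N -> (J i < J j)%N.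
Proof. by move: (valP J) => /forallP/(_ i)/forallP/(_ j)/implyP; apply. Qed.

Lemma incr_inj (J : incr) : injective J.
Proof.
move=> i j Jij; apply: ord_inj.
by case: (ltngtP i j) => // /(incr_lt J); rewrite Jij ltnn.
Qed.

Lemma incr_sorted (J : incr) : sorted ltn [seq val (J i) | i <- enum 'I_q].
Proof.
apply: (homo_sorted (e := fun i j : 'I_q => (i < j)%N)) => [i j /=|]; first exact: incr_lt.
by rewrite -(@sorted_map _ _ val ltn) val_enum_ord iota_ltn_sorted.
Qed.

Lemma incr_sub (J K : incr) : (forall i, exists j, J i = K j) -> J = K.
Proof.
move=> JK; apply: val_inj; apply/ffunP=> i; apply: val_inj.
have sJ := incr_sorted J; have sK := incr_sorted K.
have : [seq val (J i) | i <- enum 'I_q] = [seq val (K i) | i <- enum 'I_q].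
  apply: (irr_sorted_eq ltn_trans ltnn) => //.
  have uJ : uniq [seq val (J i) | i <- enum 'I_q].
    by apply: (sorted_uniq ltn_trans ltnn).
  have [] // := uniq_min_size uJ (s2 := [seq val (K i) | i <- enum 'I_q]).
    move=> _ /mapP [x _ ->]; have [y ->] := JK x.
    by apply/mapP; exists y => //; rewrite mem_enum.
  by rewrite !size_map.
by move/eq_in_map/(_ i); apply; rewrite mem_enum.
Qed.

Lemma incr_decomp (f : {ffun 'I_q -> 'I_m}) : injective f ->
  exists J : incr, exists s : 'S_q, f = [ffun i => J (s i)].
Proof.
move=> fI; pose t := [tuple f i | i < q]; pose u := sort_tuple (fun x y : 'I_m => (x <= y)%N) t.
have /tuple_permP [s ts] : perm_eq t u by rewrite perm_sym /= perm_sort.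
have usort : sorted ltn [seq val x | x <- u].
  rewrite ltn_sorted_uniq_leq (map_inj_uniq val_inj) sort_uniq map_inj_uniq ?enum_uniq //.
  by rewrite sorted_map; apply: sort_sorted => x y; apply: leq_total.
pose J0 : {ffun 'I_q -> 'I_m} := [ffun i => tnth u i].
have J0P : [forall i : 'I_q, forall j : 'I_q, (i < j)%N ==> (J0 i < J0 j)%N].
  apply/forallP=> i; apply/forallP=> j; apply/implyP=> ij; rewrite !ffunE.
  have x0 : 'I_m := J0 i.
  have sz x : (x < q)%N -> (x < size [seq val x | x <- u])%N.
    by rewrite size_map size_tuple.
  have := sorted_ltn_nth ltn_trans 0%N usort i j (sz _ (ltn_ord i)) (sz _ (ltn_ord j)) ij.
  by rewrite !(nth_map x0) ?size_tuple // -!tnth_nth.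
exists (Incr J0P), s; apply/ffunP=> i; rewrite ffunE /= ffunE.
have : tnth t i = tnth [tuple tnth u (s i) | i < q] i by rewrite !(tnth_nth (f i)) ts.
by rewrite !tnth_mktuple.
Qed.

Lemma incr_decomp_inj (J K : incr) (s t : 'S_q) :
  (forall i, J (s i) = K (t i)) -> J = K /\ s = t.
Proof.
move=> Js; have JK : J = K.
  by apply: incr_sub => i; exists (t ((s^-1)%g i)); rewrite -Js permKV.
split=> //; apply/permP=> i; apply: (@incr_inj J).
by rewrite Js JK.
Qed.

End Incr.

Section Wedge.
Variables q m : nat.

Definition ext : vectType k := {ffun incr q m -> k^o}.

(* v_1 /\ ... /\ v_q; its coordinate at e_(k_1) /\ ... /\ e_(k_q) is a q x q minor. *)
Definition wedge (v : 'I_q -> 'cV[k]_m) : ext :=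
  [ffun J : incr q m => \det (\matrix_(i, j) v i (J j) 0)].

Definition ext_basis (J : incr q m) : ext := wedge (fun i => std_basis (J i)).

Lemma ext_basisE J : ext_basis J = ffdelta J.
Proof.
apply/ffunP=> K; rewrite !ffunE; have [->|KJ] := eqVneq K J.
  rewrite -[RHS](det1 _ q); congr (\det _); apply/matrixP=> i j.
  by rewrite !mxE eqxx andbT (inj_eq (@incr_inj _ _ J)) eq_sym.
have [i iP] : exists i, [forall j, J i != incr_fun K j].
  apply/existsP; apply: contraNT KJ => /existsPn JK; apply/eqP/esym.
  apply: incr_sub => i; have := JK i; rewrite negb_forall => /existsP [j].
  by rewrite negbK => /eqP ->; exists j.
rewrite (expand_det_row _ i) big1 // => j _.
by rewrite !mxE eq_sym (negPf (forallP iP j)) mul0r.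
Qed.

(* Cauchy-Binet *)
Lemma det_mulmx_incr (A : 'M[k]_(q, m)) (B : 'M[k]_(m, q)) :
  \det (A *m B) = \sum_(J : incr q m) \det (\matrix_(i, j) A i (J j)) * \det (\matrix_(i, j) B (J i) j).
Proof.
pose F (f : {ffun 'I_q -> 'I_m}) :=
  (\prod_i A i (f i)) * \det (\matrix_(i, j) B (f i) j).
have -> : \det (A *m B) = \sum_f F f.
  rewrite /F /determinant; under [RHS]eq_bigr => f _ do rewrite mulr_sumr.
  rewrite [RHS]exchange_big; apply: eq_bigr => s _ /=.
  under [in LHS]eq_bigr => i _ do rewrite mxE.
  rewrite bigA_distr_bigA mulr_sumr; apply: eq_bigr => f _ /=.
  rewrite mulrCA big_split /=; congr (_ * (_ * _)).
  by apply: eq_bigr => i _; rewrite mxE.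
pose h (x : incr q m * 'S_q) : {ffun 'I_q -> 'I_m} := [ffun i => x.1 (x.2 i)].
have hI : injective h.
  move=> [J s] [K t] /ffunP E.
  by have [i|/= -> ->] := @incr_decomp_inj _ _ J K s t; first by have := E i; rewrite !ffunE.
rewrite (bigID (mem (h @: setT))) /= [X in _ + X]big1 ?addr0 => [|f fh]; last first.
  have /injectivePn [i [j ij fij]] : ~~ injectiveb f.
    apply: contra fh => /injectiveP /incr_decomp [J [s ->]].
    by apply/imsetP; exists (J, s).
  rewrite /F (determinant_alternate ij) ?mulr0 // => x.
  by rewrite !mxE fij.
rewrite big_imset /=; last by move=> x y _ _; apply: hI.
rewrite (eq_bigl predT) => [|x]; last by rewrite inE.
rewrite -(pair_bigA _ (fun J s => F (h (J, s)))) /=; apply: eq_bigr => J _.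
rewrite /determinant mulr_suml; apply: eq_bigr => s _; rewrite /F.
have -> : \matrix_(i, j) B (h (J, s) i) j = row_perm s (\matrix_(i, j) B (J i) j).
  by apply/matrixP=> i j; rewrite !mxE ffunE.
rewrite row_permE det_mulmx det_perm mulrCA mulrA; congr (_ * _ * _).
by apply: eq_bigr => i _; rewrite mxE ffunE.
Qed.

End Wedge.

Section Ext.
Variables (q n m : nat) (W : mxrep n m).

Definition ext_act (g : 'M[k]_n) : 'End(ext q m) :=
  linfun (fun x : {ffun incr q m -> k^o} =>
    \sum_(J : incr q m) x J *: wedge (fun i => W g *m std_basis (J i))).

Lemma ext_act_expand g (x : ext q m) :
  ext_act g x = \sum_(J : incr q m) x J *: wedge (fun i => W g *m std_basis (J i)).
Proof. by rewrite linfunE //; apply: ffun_comb_linear. Qed.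

Lemma ext_act_wedge g (v : 'I_q -> 'cV[k]_m) :
  ext_act g (wedge v) = wedge (fun i => W g *m v i).
Proof.
rewrite ext_act_expand; apply/ffunP=> K; rewrite sum_ffunE ffunE.
pose A : 'M[k]_(q, m) := \matrix_(i, j) v i j 0.
pose B : 'M[k]_(m, q) := \matrix_(i, j) W g (K j) i.
have -> : \matrix_(i, j) (W g *m v i) (K j) 0 = A *m B.
  apply/matrixP=> i j; rewrite !mxE; apply: eq_bigr => a _.
  by rewrite !mxE mulrC.
rewrite det_mulmx_incr; apply: eq_bigr => J _; rewrite !ffunE.
rewrite [LHS]/GRing.scale /=; congr GRing.mul; congr (\det _); apply/matrixP=> i j.
  by rewrite [RHS]mxE !mxE.
by rewrite [LHS]mxE mulmx_std_basis !mxE.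
Qed.

Lemma eq_ext (Z : vectType k) (f f' : 'Hom(ext q m, Z)) :
  (forall J, f (ext_basis J) = f' (ext_basis J)) -> f = f'.
Proof.
move=> ff; apply/lfunP=> x; rewrite (ffun_sum_delta x) !linear_sum.
by apply: eq_bigr => J _; rewrite !linearZ /= -ext_basisE ff.
Qed.

Lemma eq_wedge (v v' : 'I_q -> 'cV[k]_m) : v =1 v' -> wedge v = wedge v'.
Proof.
move=> vv; apply/ffunP=> J; rewrite !ffunE; congr (\det _).
by apply/matrixP=> i j; rewrite !mxE vv.
Qed.

Lemma ext_act1 : ext_act 1%:M = \1%VF.
Proof.
apply: eq_ext => J; rewrite ext_act_wedge id_lfunE.
by apply: eq_wedge => i; rewrite mxact1 mul1mx.
Qed.

Lemma ext_actM :
  {in unitmx &, forall g h, ext_act (g *m h) = (ext_act g \o ext_act h)%VF}.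
Proof.
move=> g h gu hu; apply: eq_ext => J; rewrite comp_lfunE !ext_act_wedge.
by apply: eq_wedge => i; rewrite mxactM // mulmxA.
Qed.

Lemma ext_act_regular (phi : 'Hom(ext q m, k^o)) x :
  regular (fun g => phi (ext_act g x)).
Proof.
apply: (@regular_expand n (ext q m) (incr q m) predT (fun g => ext_act g x)
  (fun K g => \sum_(J : incr q m) (x : {ffun incr q m -> k^o}) J *
     \det (\matrix_(i, j) W g (K j) (J i)))
  (@ffdelta _)) => [K _|g].
  apply: regular_sum => J _; apply: regular_mul; first exact: regular_const.
  apply: regular_det => i j; apply: (regular_eq (mxact_regular W (K j) (J i))).
  by move=> g; rewrite mxE.
rewrite [LHS]ffun_sum_delta; apply: eq_bigr => K _; congr (_ *: _).
rewrite ext_act_expand sum_ffunE; apply: eq_bigr => J _.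
rewrite !ffunE [LHS]/GRing.scale /=; congr GRing.mul; congr (\det _).
by apply/matrixP=> i j; rewrite [LHS]mxE mulmx_std_basis mxE.
Qed.

Definition ext_rep : rep n := Rep ext_act1 ext_actM ext_act_regular.
End Ext.

(* Exactness of 0 -> C N.+1 -> C N -> ... -> C 0 -> 0 in the category of
   representations of GL(n), for d q : C q.+1 -> C q. *)
Definition exact_sequence (n : nat) (C : nat -> rep n)
    (d : forall q, 'Hom(C q.+1, C q)) (N : nat) : Prop :=
  [/\ forall q, (q <= N)%N -> equivariant (d q),
      lker (d N) = 0%VS,
      forall q, (q < N)%N -> limg (d q.+1) = lker (d q) &
      limg (d 0%N) = fullv].

Section Standard.
Variables (n : nat).

(* Sym^j(V), zero for j < 0 *)
Definition Sym (j : int) : rep n :=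
  match j with
  | Posz d => sym_rep d (std n)
  | Negz _ => col_rep (zero_mxrep n)
  end.

Definition T (l : nat) : rep n := T_rep l (std n).

(* e_1^{a_1} ... e_n^{a_n} |-> v(a_1, ..., a_n) *)
Definition sym_to_T (l : nat) : 'Hom(Sym l, T l) :=
  linfun (fun f : sympow n l => vsproj (Tspace l n)
    (\sum_(a : 'X_{1..n < l.+1} | mdeg (val a) == l) f@_(val a) *: vsym l (val a))).

Lemma sym_to_TE (l : nat) (f : sympow n l) :
  vsval (sym_to_T l f) =
    \sum_(a : 'X_{1..n < l.+1} | mdeg (val a) == l) f@_(val a) *: vsym l (val a).
Proof.
rewrite linfunE ?vsprojK //.
  by apply: rpred_sum => a /eqP al; apply/rpredZ/vsym_T.
move=> c x y; rewrite -[RHS]linearP; congr (vsproj _ _).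
rewrite scaler_sumr -big_split; apply: eq_bigr => a _ /=.
by rewrite mcoeffD mcoeffZ scalerDl scalerA.
Qed.

Section Koszul.
Variables (p : nat) (charkp : p \in [pchar k]).

(* Sym^j(V) (x) /\^q(F^* V) *)
Definition koszul_term (j : int) (q : nat) : rep n :=
  tens_rep (Sym j) (ext_rep q (frob_std n charkp)).

(* f |-> e_i^p f, projected to degree b; only used for b = a + p, where the
   projection does nothing. *)
Definition mul_pow (a b : nat) (i : 'I_n) (f : sympow n a) : sympow n b :=
  sym_proj b ('X_i ^+ p * f).

Definition koszul_phi (a b q : nat) :
    'Hom(koszul_term a q.+1, koszul_term b q) :=
  tens_lift (fun (f : sympow n a) (x : ext q.+1 n) =>
    \sum_(J : incr q.+1 n) x J *: \sum_(i < q.+1) (-1) ^+ i *: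
      tens (mul_pow b (J i) f : sym_rep b (std n))
           (wedge (fun j => std_basis (J (lift i j))) : ext_rep q (frob_std n charkp))).

Lemma mul_powE (a b : nat) i f : b = (a + p)%N ->
  (@mul_pow a b i f : {mpoly k[n]}) = 'X_i ^+ p * f.
Proof.
move=> ->; apply: sym_projE; rewrite addnC.
apply: dhomogM; last exact: sympow_homog.
rewrite -[X in _ \is X.-homog for mdeg]mul1n; apply: dhomogMn.
by rewrite dhomogX; apply/eqP/mdeg1.
Qed.

Lemma koszul_phiE (a b q : nat) (f : sympow n a) (J : incr q.+1 n) :
  koszul_phi a b q (tens (f : sym_rep a (std n))
                         (ext_basis J : ext_rep q.+1 (frob_std n charkp)))
  = \sum_(i < q.+1) (-1) ^+ i *:
      tens (mul_pow b (J i) f : sym_rep b (std n))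
           (wedge (fun j => std_basis (J (lift i j))) : ext_rep q (frob_std n charkp)).
Proof.
rewrite tens_liftE => [|h|x c h h'].
- rewrite ext_basisE (bigD1 J) //= [X in _ + X]big1 => [|K KJ].
    by rewrite addr0 ffunE eqxx scale1r.
  by rewrite ffunE (negPf KJ) scale0r.
- exact: (@ffun_comb_linear (incr q.+1 n) _ (fun J => \sum_(i < q.+1)
    (-1) ^+ i *: tens (mul_pow b (J i) h : sym_rep b (std n))
      (wedge (fun j => std_basis (J (lift i j))) : ext_rep q (frob_std n charkp)))).
have ml i : linear (@mul_pow a b i).
  move=> e u v; rewrite /mul_pow -sym_proj_linear; congr sym_proj.
  by rewrite -[sympoly _]/(e *: (u : {mpoly k[n]}) + v) mulrDr -scalerAr.
rewrite scaler_sumr -big_split; apply: eq_bigr => K _ /=.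
rewrite scalerA mulrC -scalerA -scalerDr; congr (_ *: _).
rewrite scaler_sumr -big_split; apply: eq_bigr => i _ /=.
by rewrite ml tensl_linear scalerDr !scalerA mulrC.
Qed.

(* Sym^l(V) (x) /\^0(F^* V) = Sym^l(V) *)
Definition koszul_unit (l : nat) : 'Hom(koszul_term l 0, Sym l) :=
  tens_lift (fun (f : sympow n l) (x : ext 0 n) => \sum_(J : incr 0 n) x J *: f).

(* T^l(V), Sym^l(V), Sym^{l-p}(V) (x) /\^1(F^* V), Sym^{l-2p}(V) (x) /\^2(F^* V), ...
   Only the terms with q * p <= l are used, so the subtractions are exact. *)
Definition koszul_seq (l q : nat) : rep n :=
  match q with
  | 0 => T l
  | 1 => Sym l
  | q'.+1 => koszul_term (l - q' * p)%N q'
  end.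

Definition koszul_map (l q : nat) : 'Hom(koszul_seq l q.+1, koszul_seq l q) :=
  match q with
  | 0 => sym_to_T l
  | 1 => (koszul_unit l \o koszul_phi (l - 1 * p) l 0)%VF
  | q'.+1 => koszul_phi (l - q'.+1 * p) (l - q' * p) q'
  end.

End Koszul.
End Standard.

End Representations.

Arguments Sym k n j : clear implicits.
Arguments T k n l : clear implicits.
Arguments det_mxrep k n d : clear implicits.
Arguments exact_sequence {k n} C d N.

(* Main.v *)
From HB Require Import structures.
From mathcomp Require Import all_boot all_order all_algebra all_fingroup pgroup.
From mathcomp Require Import zify ring.
From mathcomp.multinomials Require Import mpoly.
Require Import Defs.

Set Implicit Arguments.
Unset Strict Implicit.
Unset Printing Implicit Defensive.

Import GRing.Theory.
Local Open Scope ring_scope.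

(** The map from Sym^l(V) to T^l(V) is onto, and its kernel is the degree l part of the ideal
   (e_1^p, ..., e_n^p): the coordinates of v(a) count permutations and are, where nonzero,
   the order of the stabilizer of a word with content a, so that v(a) = 0 exactly when some
   a_j >= p (dvdn_stab, sym_to_T_large, sym_to_T_ker). Thus T^l(V) is the degree l part
   of k[e_1, ..., e_n] / (e_1^p, ..., e_n^p).

   (ii) The complex is the degree l part of the Koszul complex of the regular sequence
   e_1^p, ..., e_n^p, a resolution of that quotient. Exactness is proved by an explicit
   contracting homotopy. The complex splits by multidegree into augmented chain complexes of
   simplices, each of which is contracted by the cone over its least vertex
   (koszul_htpy_id). For the rest it is convenient to have phi on all decomposable
   vectors, not only on a basis: the defining formula persists, with the p-th power of a
   basis vector replaced by the additive map pform from F^*V to Sym^p(V) (phi_wedge).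
   This yields equivariance (phi_equivariant), and presents phi o phi through
   determinants with two equal columns (phi_phi).

   (i) For l < p the complex has length zero and Sym^l(V) = T^l(V). For p <= l <= 2(p-1)
   write m = 2(p-1) - l and d = l - (p-1), so that m + d = p - 1. The isomorphism from
   Sym^m(V) (x) det^d sends v^m to v^(p-1) w^d for any w with det(v, w) = 1; changing
   w by a multiple of v changes nothing as v^p = 0 in T, and equivariance is then
   immediate. That this extends to a linear map is seen on coefficients
   (dual_hom_powers), and that it is determined by the powers v^m follows from
   m < p (eq_powers). For l > 2(p-1) both sides vanish. *)

(** * Tensor products, symmetric powers and coordinates *)

Section Tensors.
Variable k : fieldType.

Lemma tens_ind (U W : vectType k) (P : tens_sp U W -> Prop) :
  P 0 -> (forall s t, P s -> P t -> P (s + t)) -> (forall u w, P (tens u w)) ->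
  forall t, P t.
Proof.
move=> P0 PD Pt t; rewrite (matrix_sum_delta t).
elim/big_ind: _ => // i _; elim/big_ind: _ => // j _.
rewrite -tens_delta.
have -> (c : k) (v : U) : c *: tens v (vbasis {:W})`_j = tens (c *: v) (vbasis {:W})`_j.
  by apply/matrixP=> a b; rewrite !mxE linearZ /= mulrA.
exact: Pt.
Qed.

Lemma tens_suml (U W : vectType k) (I : Type) (r : seq I) (P : pred I)
    (c : I -> k) (u : I -> U) (w : W) :
  tens (\sum_(i <- r | P i) c i *: u i) w =
  \sum_(i <- r | P i) c i *: tens (u i) w.
Proof. exact: (linear_sumZ _ _ _ _ (@tensl_linear k U W w)). Qed.

Lemma tens_sumr (U W : vectType k) (I : Type) (r : seq I) (P : pred I)
    (c : I -> k) (u : U) (w : I -> W) :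
  tens u (\sum_(i <- r | P i) c i *: w i) =
  \sum_(i <- r | P i) c i *: tens u (w i).
Proof. exact: (linear_sumZ _ _ _ _ (@tensr_linear k U W u)). Qed.

Lemma tensZl (U W : vectType k) c (u : U) (w : W) : tens (c *: u) w = c *: tens u w.
Proof. by apply/matrixP=> i j; rewrite !mxE linearZ /= mulrA. Qed.

Lemma tensZr (U W : vectType k) c (u : U) (w : W) : tens u (c *: w) = c *: tens u w.
Proof. by apply/matrixP=> i j; rewrite !mxE linearZ /= mulrCA. Qed.

Lemma tens0l (U W : vectType k) (w : W) : tens (0 : U) w = 0.
Proof. by rewrite -(scale0r (0 : U)) tensZl scale0r. Qed.

Lemma tensDl (U W : vectType k) (u u' : U) (w : W) :
  tens (u + u') w = tens u w + tens u' w.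
Proof. by have := tensl_linear w 1 u u'; rewrite !scale1r. Qed.

Lemma tens_line (U W : vectType k) (w0 : W) :
  (forall w, exists c, w = c *: w0) -> forall t : tens_sp U W, exists u, t = tens u w0.
Proof.
move=> line; apply: tens_ind => [|_ _ [u ->] [v ->]|u w].
- by exists 0; rewrite tens0l.
- by exists (u + v); rewrite tensDl.
by have [c ->] := line w; exists (c *: u); rewrite tensZl tensZr.
Qed.

Lemma scaler_lrlinear (U W : vectType k) (phi : W -> k) : linear (phi : W -> k^o) ->
  (forall u : U, linear (fun w : W => phi w *: u))
  /\ (forall w : W, linear (fun u : U => phi w *: u)).
Proof.
move=> lphi; split=> [u c w w'|w c u u'].
  by rewrite lphi scalerDl scalerA.
by rewrite scalerDr !scalerA mulrC.
Qed.

Lemma rep_iso_sym n (U W : rep k n) : rep_iso U W -> rep_iso W U.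
Proof.
case=> f [fE f0 f1].
have fi : injective f by apply/lker0P; rewrite f0.
have fK : cancel f (f^-1)%VF by move=> x; apply: lker0_lfunK; rewrite f0.
have Kf x : f ((f^-1)%VF x) = x by apply: limg_lfunVK; rewrite f1 memvf.
exists (f^-1)%VF; split.
- move=> g gu; apply/lfunP=> x; rewrite !comp_lfunE; apply: fi.
  by rewrite Kf -comp_lfunE fE // comp_lfunE Kf.
- by apply/eqP/lker0P => x y /(congr1 f); rewrite !Kf.
apply/vspaceP=> x; rewrite memvf -[x]fK; apply: memv_img; exact: memvf.
Qed.

End Tensors.

Section SymmetricPowers.
Variables (k : fieldType) (n d : nat).

HB.instance Definition _ :=
  GRing.isLinear.Build k {mpoly k[n]} (sympow k n d) _ (@sym_proj k n d)
    (@sym_proj_linear k n d).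

Lemma sympoly_sum (I : Type) (r : seq I) (P : pred I) (F : I -> sympow k n d) :
  (\sum_(i <- r | P i) F i : sympow k n d)
  = \sum_(i <- r | P i) (F i : {mpoly k[n]}) :> {mpoly k[n]}.
Proof. by elim/big_ind2: _ => // f f1 g g1 <- <-. Qed.

End SymmetricPowers.

Section Coordinates.
Variables (k : fieldType) (n q a : nat).
Let KT := tens_sp (sympow k n a) (ext k q n).

(** An element of Sym^a (x) /\^q is a family of polynomials indexed by the basis e_K
   of the exterior power; ext_coord K reads off the polynomial at e_K. *)
Definition ext_coord (K : incr q n) : 'Hom(KT, sympow k n a) :=
  tens_lift (fun (f : sympow k n a) (x : ext k q n) => (x K : k) *: f).

Lemma ext_coordE K (f : sympow k n a) (x : ext k q n) :
  ext_coord K (tens f x) = (x K : k) *: f.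
Proof.
have lK : linear ((fun x : ext k q n => x K) : _ -> k^o) by move=> c y z; rewrite !ffunE.
by have [l1 l2] := scaler_lrlinear (sympow k n a) lK; rewrite tens_liftE.
Qed.

Lemma ext_basis_expand (x : ext k q n) : x = \sum_K x K *: ext_basis k K.
Proof. by rewrite {1}[x]ffun_sum_delta; apply: eq_bigr => K _; rewrite ext_basisE. Qed.

Lemma ext_coord_expand (t : KT) : t = \sum_K tens (ext_coord K t) (ext_basis k K).
Proof.
move: t; apply: tens_ind => [|s t sE tE|f x].
- by rewrite big1 // => K _; rewrite linear0 tens0l.
- rewrite {1}sE {1}tE -big_split; apply: eq_bigr => K _.
  by rewrite linearD tensDl.
rewrite {1}(ext_basis_expand x) tens_sumr.
by apply: eq_bigr => K _; rewrite ext_coordE tensZl.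
Qed.

Lemma ext_coord_inj (s t : KT) : (forall K, ext_coord K s = ext_coord K t) -> s = t.
Proof.
move=> st; rewrite [s]ext_coord_expand [t]ext_coord_expand.
by apply: eq_bigr => K _; rewrite st.
Qed.

(** The projection to degree d makes this total; it is zero unless al has degree d. *)
Definition mono d (al : 'X_{1..n}) : sympow k n d := sym_proj d 'X_[al].

Lemma monoE d al : mdeg al = d -> (mono d al : {mpoly k[n]}) = 'X_[al].
Proof. by move=> ald; apply: sym_projE; rewrite dhomogX; apply/eqP. Qed.

Lemma mono_expand d (f : sympow k n d) :
  f = \sum_(al : {al : 'X_{1..n < d.+1} | mdeg (val al) == d})
        f@_(val (val al)) *: mono d (val (val al)).
Proof.
rewrite {1}[f]sympow_expand; apply: eq_bigr => al _; congr (_ *: _).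
by apply: val_inj; rewrite [RHS]monoE //; apply/eqP/(valP al).
Qed.

Lemma mcoeff_mono_sum d (c : 'X_{1..n} -> k) be : mdeg be = d ->
  (\sum_(al : {al : 'X_{1..n < d.+1} | mdeg (val al) == d})
      c (val (val al)) *: mono d (val (val al)))@_be = c be.
Proof.
move=> bed; have lt_be : (mdeg be < d.+1)%N by rewrite bed.
have beI : mdeg (val (BMultinom lt_be)) == d by rewrite /= bed.
pose i0 : {al : 'X_{1..n < d.+1} | mdeg (val al) == d} := exist _ (BMultinom lt_be) beI.
rewrite mcoeff_sym_sum -[be]/(val (val i0)) (bigD1 i0) // big1 => [|i ii0].
  by rewrite monoE // mcoeffX eqxx mulr1 /= addr0.
rewrite monoE ?(eqP (valP i)) // mcoeffX !(inj_eq val_inj).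
by rewrite (negPf ii0) mulr0.
Qed.

Lemma eq_mono d (Z : vectType k) (h h' : 'Hom(sympow k n d, Z)) :
  (forall al, mdeg al = d -> h (mono d al) = h' (mono d al)) -> h = h'.
Proof.
move=> hh; apply/lfunP=> f; rewrite (mono_expand f) !linear_sum.
by apply: eq_bigr => al _; rewrite !linearZ /= hh //; apply/eqP/(valP al).
Qed.

Lemma eq_mono_ext (Z : vectType k) (h h' : 'Hom(KT, Z)) :
  (forall al J, mdeg al = a -> h (tens (mono a al) (ext_basis k J))
                             = h' (tens (mono a al) (ext_basis k J))) -> h = h'.
Proof.
move=> hh; apply: eq_tens => f x.
rewrite (ext_basis_expand x) tens_sumr !linear_sum; apply: eq_bigr => J _.
rewrite !linearZ /=; congr (_ *: _); rewrite (mono_expand f) tens_suml !linear_sum.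
by apply: eq_bigr => al _; rewrite !linearZ /= hh //; apply/eqP/(valP al).
Qed.

Lemma eq_tens_wedge (Z : vectType k) (h h' : 'Hom(KT, Z)) :
  (forall f v, h (tens f (wedge v)) = h' (tens f (wedge v))) -> h = h'.
Proof. by move=> hh; apply: eq_mono_ext => al J _; apply: hh. Qed.

End Coordinates.

Arguments ext_coord {k n q a} K.
Arguments mono k {n} d al : simpl never.

(** * The Koszul differential on decomposable vectors *)

Section Prepend.

Definition fcons (T : Type) q (x : T) (f : 'I_q -> T) (i : 'I_q.+1) : T :=
  oapp f x (unlift ord0 i).

Lemma fcons0 T q (x : T) (f : 'I_q -> T) : fcons x f ord0 = x.
Proof. by rewrite /fcons unlift_none. Qed.

Lemma fconsS T q (x : T) (f : 'I_q -> T) i : fcons x f (lift ord0 i) = f i.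
Proof. by rewrite /fcons liftK. Qed.

(** Laplace expansion along the first column, in the form in which the alternating sum
   of the Koszul differential appears on the right. *)
Lemma det_fcons (R : comNzRingType) q (c : 'I_q.+1 -> R) (M : 'I_q.+1 -> 'I_q -> R) :
  \det (\matrix_(i, j) fcons (c i) (M i) j) =
  \sum_(i < q.+1) (-1) ^+ i * c i * \det (\matrix_(i', j) M (lift i i') j).
Proof.
rewrite (expand_det_col _ ord0); apply: eq_bigr => i _.
rewrite mxE fcons0 /cofactor addn0 mulrCA mulrA; congr (_ * \det _).
by apply/matrixP=> i' j; rewrite !mxE fconsS.
Qed.

End Prepend.

Section Contraction.
Variables (k : fieldType) (n q : nat).

(** Interior multiplication by the j-th coordinate functional, which the
   Koszul differential performs on basis vectors, is given by the expected
   formula on every decomposable vector. At e_K both sides compute the determinant of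
   [v_j | v_K]: the left-hand side by Cauchy-Binet, the other one by Laplace
   expansion. *)
Lemma contract_wedge (v : 'I_q.+1 -> 'cV[k]_n) (j : 'I_n) :
  \sum_(J : incr q.+1 n) (wedge v J : k) *:
     (\sum_(i < q.+1) ((-1) ^+ i * (J i == j)%:R) *:
        wedge (fun i' => std_basis k (J (lift i i'))))
  = \sum_(i < q.+1) ((-1) ^+ i * v i j 0) *: wedge (fun i' => v (lift i i')).
Proof.
apply/ffunP=> K; rewrite !sum_ffunE.
pose A : 'M[k]_(q.+1, n) := \matrix_(i, c) v i c 0.
pose B : 'M[k]_(n, q.+1) := \matrix_(c, b) fcons (c == j)%:R (fun b => (c == K b)%:R) b.
have AB : A *m B = \matrix_(i, b) fcons (v i j 0) (fun b => v i (K b) 0) b.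
  have selE (i : 'I_q.+1) (c0 : 'I_n) : \sum_c A i c * (c == c0)%:R = v i c0 0.
    rewrite (bigD1 c0) //= big1 => [|c /negPf cc0]; first by rewrite mxE eqxx mulr1 addr0.
    by rewrite cc0 mulr0.
  apply/matrixP=> i b; rewrite !mxE.
  have [b' ->|->] := unliftP ord0 b.
    by rewrite fconsS -selE; apply: eq_bigr => c _; rewrite [B _ _]mxE fconsS.
  by rewrite fcons0 -selE; apply: eq_bigr => c _; rewrite [B _ _]mxE fcons0.
transitivity (\det (A *m B)); last first.
  rewrite AB det_fcons; apply: eq_bigr => i _; rewrite !ffunE.
  by congr (_ * \det _); apply/matrixP=> i' b; rewrite !mxE.
rewrite det_mulmx_incr; apply: eq_bigr => J _; rewrite ffunE [LHS]/GRing.scale /=.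
rewrite ffunE; congr (_ * _).
  by congr (\det _); apply/matrixP=> i b; rewrite !mxE.
rewrite sum_ffunE -[RHS]/(\det _).
have -> : \matrix_(i, b) B (J i) b
        = \matrix_(i, b) fcons (J i == j)%:R (fun b => (J i == K b)%:R) b :> 'M[k]_q.+1.
  by apply/matrixP=> i b; rewrite !mxE.
rewrite det_fcons; apply: eq_bigr => i _; rewrite !ffunE.
congr (_ * \det _); apply/matrixP=> i' b; rewrite !mxE eqxx andbT.
by rewrite eq_sym.
Qed.

End Contraction.

Section Differential.
Variables (k : fieldType) (n p : nat) (charkp : p \in [pchar k]).

Local Notation phi := (koszul_phi n charkp).

(** The linear map from F^*V to Sym^p(V) sending e_j to e_j^p. *)
Definition pform (v : 'cV[k]_n) : {mpoly k[n]} := \sum_j v j 0 *: 'X_j ^+ p.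

Definition mul_pform a b (v : 'cV[k]_n) (f : sympow k n a) : sympow k n b :=
  sym_proj b (pform v * f).

Lemma pform_std j : pform (std_basis k j) = 'X_j ^+ p.
Proof.
rewrite /pform (bigD1 j) //= big1 => [|i /negPf ij]; first by rewrite mxE !eqxx scale1r addr0.
by rewrite mxE ij scale0r.
Qed.

Lemma pform_homog v : pform v \is p.-homog.
Proof.
apply: rpred_sum => j _; apply: rpredZ.
have X1 : ('X_j : {mpoly k[n]}) \is 1.-homog by rewrite dhomogX; apply/eqP/mdeg1.
by have := dhomogMn p X1; rewrite mul1n.
Qed.

Lemma mul_pformE a b v (f : sympow k n a) : b = (a + p)%N ->
  (mul_pform b v f : {mpoly k[n]}) = pform v * f.
Proof.
by move=> ->; apply: sym_projE; rewrite addnC; apply: dhomogM (pform_homog v) (sympow_homog f).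
Qed.

Lemma mul_pform_std a b j (f : sympow k n a) :
  mul_pform b (std_basis k j) f = mul_pow p b j f.
Proof. by rewrite /mul_pform pform_std. Qed.

Lemma mul_pform_sum a b v (f : sympow k n a) :
  mul_pform b v f = \sum_j v j 0 *: mul_pow p b j f.
Proof.
rewrite /mul_pform /pform mulr_suml.
by rewrite linear_sum; apply: eq_bigr => j _; rewrite -scalerAl linearZ.
Qed.

(** The formula that defines phi on basis vectors holds for all v_1 /\ ... /\ v_q, with
   pform v in place of e_k^p. It is basis-free, hence equivariance follows from it. *)
Lemma phi_wedge a b q (f : sympow k n a) (v : 'I_q.+1 -> 'cV[k]_n) :
  phi a b q (tens f (wedge v)) =
  \sum_(i < q.+1) (-1) ^+ i *: tens (mul_pform b (v i) f) (wedge (fun i' => v (lift i i'))).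
Proof.
rewrite {1}(ext_basis_expand (wedge v)) tens_sumr linear_sum /=.
pose tn (j : 'I_n) (x : ext k q n) := tens (mul_pow p b j f) x.
transitivity (\sum_j tn j (\sum_(J : incr q.+1 n) (wedge v J : k) *:
     (\sum_(i < q.+1) ((-1) ^+ i * (J i == j)%:R) *:
        wedge (fun i' => std_basis k (J (lift i i')))))).
  rewrite /tn; under [RHS]eq_bigr => j _ do rewrite tens_sumr.
  rewrite exchange_big; apply: eq_bigr => J _; rewrite linearZ /= koszul_phiE.
  rewrite -scaler_sumr; congr (_ *: _).
  under [RHS]eq_bigr => j _ do rewrite tens_sumr.
  rewrite exchange_big; apply: eq_bigr => i _ /=.
  rewrite (bigD1 (J i)) //= big1 => [|j /negPf jJ]; first by rewrite eqxx mulr1 addr0.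
  by rewrite eq_sym jJ mulr0 scale0r.
rewrite (eq_bigr _ (fun j _ => congr1 (tn j) (contract_wedge v j))) /tn.
under eq_bigr => j _ do rewrite tens_sumr.
rewrite exchange_big; apply: eq_bigr => i _; rewrite mul_pform_sum tens_suml scaler_sumr.
by apply: eq_bigr => j _; rewrite scalerA.
Qed.

(** Laplace expansion, read backwards, turns the alternating sum into one determinant
   over the polynomial ring, bordered by the p-th powers. *)
Lemma ext_coord_phi a b q (f : sympow k n a) (v : 'I_q.+1 -> 'cV[k]_n) (K : incr q n) :
  b = (a + p)%N ->
  (ext_coord K (phi a b q (tens f (wedge v))) : {mpoly k[n]})
  = \det (\matrix_(i, j) fcons (pform (v i)) (fun j => (v i (K j) 0)%:MP) j) * f.
Proof.
move=> ab; rewrite phi_wedge linear_sum /= det_fcons mulr_suml.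
rewrite sympoly_sum; apply: eq_bigr => i _; rewrite linearZ /= ext_coordE ffunE.
rewrite -[LHS]/((-1) ^+ i *: (_ *: (mul_pform b (v i) f : {mpoly k[n]}))) mul_pformE //.
set M := \matrix_(_, _) _; set N := \matrix_(_, _) _.
have -> : \det N = (\det M)%:MP.
  by rewrite -det_map_mx; congr (\det _); apply/matrixP=> r c; rewrite !mxE.
by rewrite -!mul_mpolyC rmorphXn rmorphN rmorph1 /= !mulrA; congr (_ * _); rewrite mulrAC.
Qed.

(** At e_K the composite is a determinant bordered twice by the same column of p-th
   powers. This replaces the pairing of terms of opposite sign. *)
Lemma phi_phi a b c q : b = (a + p)%N -> c = (b + p)%N ->
  (phi b c q \o phi a b q.+1)%VF = 0.
Proof.
move=> ab bc; apply: eq_tens_wedge => f v; rewrite lfunE /= zero_lfunE.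
apply: ext_coord_inj => K; apply: val_inj; rewrite linear0.
rewrite phi_wedge !linear_sum /=.
pose M := \matrix_(i, j) fcons (pform (v i))
  (fcons (pform (v i)) (fun j => (v i (K j) 0)%:MP)) j.
have M0 : \det M = 0 :> {mpoly k[n]}.
  rewrite -det_tr (@determinant_alternate _ _ _ ord0 (lift ord0 ord0)) // => i.
  by rewrite !mxE fconsS !fcons0.
transitivity (\det M * f); last by rewrite M0 mul0r.
rewrite /M det_fcons mulr_suml.
apply: eq_bigr => i _; rewrite !linearZ /=.
rewrite -[LHS]/((-1) ^+ i *: (ext_coord K _ : {mpoly k[n]})) ext_coord_phi // mul_pformE //.
by rewrite -mul_mpolyC rmorphXn rmorphN rmorph1 /= -!mulrA; congr (_ * _); rewrite mulrCA.
Qed.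

End Differential.

(** * Equivariance of the differential *)

Section Equivariance.
Variables (k : fieldType) (n p : nat) (charkp : p \in [pchar k]).
Local Notation F := (frob_std n charkp).

Lemma koszul_act_wedge a q g (f : sympow k n a) (v : 'I_q -> 'cV[k]_n) :
  act (koszul_term n charkp a q) g (tens f (wedge v)) =
  tens (sym_act a (std k n) g f) (wedge (fun i => F g *m v i)).
Proof. by rewrite [LHS]tens_homE -ext_act_wedge. Qed.

(** The map pform is equivariant from F^*V to Sym^p(V), because raising to the p-th power
   is additive in characteristic p. *)
Lemma pform_subst (g : 'M[k]_n) (v : 'cV[k]_n) :
  pform p v \mPo lin_subst g = pform p (F g *m v).
Proof.
have charP : p \in [pchar {mpoly k[n]}] by rewrite pchar_lalg.
rewrite /pform [X in X \mPo _]/= linear_sum /=.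
under [RHS]eq_bigr => j _ do rewrite mxE scaler_suml.
rewrite exchange_big; apply: eq_bigr => i _ /=.
rewrite linearZ /= rmorphXn /= comp_mpolyXU -tnth_nth tnth_mktuple.
rewrite -(pFrobenius_autE charP) rmorph_sum scaler_sumr; apply: eq_bigr => j _ /=.
by rewrite pFrobenius_autE exprZn scalerA mulrC mxE.
Qed.

Lemma phi_equivariant a b q : b = (a + p)%N ->
  equivariant (koszul_phi n charkp a b q).
Proof.
move=> ab g gu; apply: eq_tens_wedge => f v.
rewrite [LHS]comp_lfunE [RHS]comp_lfunE.
rewrite [in LHS]koszul_act_wedge.
rewrite [LHS]phi_wedge.
rewrite [in RHS]phi_wedge linear_sum.
apply: eq_bigr => i _.
rewrite linearZ /=; congr (_ *: _); rewrite [RHS]koszul_act_wedge; congr tens.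
apply: val_inj; rewrite [LHS]mul_pformE // [RHS]sym_actE sym_actE mul_pformE //.
by rewrite rmorphM /= pform_subst.
Qed.

End Equivariance.

(** * The contracting homotopy *)

Section Homotopy.
Variables (k : fieldType) (n p : nat) (charkp : p \in [pchar k]).
Implicit Types (al : 'X_{1..n}) (s j : 'I_n).

Local Notation phi := (koszul_phi n charkp).

Definition below q s (J : incr q n) := [forall i, s < J i]%N.

Definition small_before s al := [forall j : 'I_n, (j < s)%N ==> (al j < p)%N].

Definition first_large s al := (p <= al s)%N && small_before s al.

(** Division by e_s^p, restricted to the monomials whose least index with exponent at
   least p is s. *)
Definition div_pow (a b : nat) s (f : sympow k n a) : sympow k n b :=
  \sum_(al : {al : 'X_{1..n < a.+1} | mdeg (val al) == a} | first_large s (val (val al)))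
     f@_(val (val al)) *: mono k b (val (val al) - U_(s) *+ p).

Definition ext_prepend q s (J : incr q n) : ext k q.+1 n :=
  wedge (fun i => std_basis k (fcons s J i)).

(** The complex splits by multidegree, the multidegree of e^al (x) e_J being al + p 1_J.
   In multidegree be it is the augmented chain complex of the simplex whose vertices
   are the j with be_j >= p, a subset J standing for e^(be - p 1_J) (x) e_J. A simplex is
   contracted by the cone over one of its vertices. The least vertex s is used: it is
   prepended to J without a sign, and it applies to J exactly when s < J_0. *)
Definition koszul_htpy (a b q : nat) :
    'Hom(koszul_term n charkp a q, koszul_term n charkp b q.+1) :=
  tens_lift (fun (f : sympow k n a) (x : ext k q n) =>
    \sum_(J : incr q n) (x J : k) *: \sum_(s | below s J)
      tens (div_pow b s f) (ext_prepend s J)).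

Lemma div_pow_mono a b s al : mdeg al = a ->
  div_pow b s (mono k a al) = if first_large s al then mono k b (al - U_(s) *+ p) else 0.
Proof.
move=> ala; rewrite /div_pow.
have lt_al : (mdeg al < a.+1)%N by rewrite ala.
have alI : mdeg (val (BMultinom lt_al)) == a by rewrite /= ala.
pose i0 : {al : 'X_{1..n < a.+1} | mdeg (val al) == a} := exist _ (BMultinom lt_al) alI.
have z i : i != i0 -> (mono k a al)@_(val (val i)) = 0.
  by rewrite monoE // mcoeffX -(inj_eq val_inj) -(inj_eq val_inj) eq_sym /= => /negPf ->.
case: ifP => fl; last first.
  rewrite big1 // => i fli; rewrite z ?scale0r //.
  by apply/eqP => ii; move: fli; rewrite ii /= fl.
rewrite (bigD1 i0) // big1 => [|i /andP [_ ii0]]; last by rewrite z ?scale0r.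
by rewrite -[val (val i0)]/al monoE // mcoeffX eqxx scale1r /= addr0.
Qed.

Lemma div_pow_linear a b s : linear (@div_pow a b s).
Proof.
move=> c f h; rewrite /div_pow scaler_sumr -big_split; apply: eq_bigr => al _ /=.
rewrite scalerA -scalerDl; congr (_ *: _).
by rewrite mcoeffD mcoeffZ.
Qed.

Lemma koszul_htpyE a b q (f : sympow k n a) (J : incr q n) :
  koszul_htpy a b q (tens f (ext_basis k J))
  = \sum_(s | below s J) tens (div_pow b s f) (ext_prepend s J).
Proof.
rewrite tens_liftE => [|h|x c h h'].
- rewrite ext_basisE (bigD1 J) //= [X in _ + X]big1 => [|K KJ].
    by rewrite addr0 ffunE eqxx scale1r.
  by rewrite ffunE (negPf KJ) scale0r.
- exact: (@ffun_comb_linear k (incr q n) _ (fun J => \sum_(s | below s J)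
    tens (div_pow b s h) (ext_prepend s J) : koszul_term n charkp b q.+1)).
rewrite scaler_sumr -big_split; apply: eq_bigr => K _ /=.
rewrite scalerA mulrC -scalerA -scalerDr; congr (_ *: _).
rewrite scaler_sumr -big_split; apply: eq_bigr => s _ /=.
by rewrite div_pow_linear tensl_linear.
Qed.

Lemma mul_pow_mono a b j al : mdeg al = a -> b = (a + p)%N ->
  mul_pow p b j (mono k a al) = mono k b (al + U_(j) *+ p).
Proof.
move=> ala ab; apply: val_inj; rewrite [LHS]mul_powE // monoE // [RHS]monoE.
  by rewrite mpolyXD mpolyXn mulrC.
by rewrite mdegD mdegMn mdeg1 ala ab mul1n.
Qed.

Lemma incr_lift_subproof q (J : incr q.+1 n) (i : 'I_q.+1) :
  [forall a : 'I_q, forall b : 'I_q,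
     (a < b)%N ==> ([ffun x => J (lift i x)] a < [ffun x => J (lift i x)] b)%N].
Proof.
apply/forallP=> a; apply/forallP=> b; apply/implyP=> ab; rewrite !ffunE.
by apply: incr_lt; rewrite /= /bump; case: leqP; case: leqP; lia.
Qed.

Definition incr_lift q (J : incr q.+1 n) i : incr q n := Incr (incr_lift_subproof J i).

Lemma ext_basis_lift q (J : incr q.+1 n) (i : 'I_q.+1) :
  wedge (fun i' => std_basis k (J (lift i i'))) = ext_basis k (incr_lift J i).
Proof. by apply: eq_wedge => i'; rewrite /= ffunE. Qed.

Lemma ext_prepend_lift q s (J : incr q.+1 n) (i : 'I_q.+1) :
  wedge (fun i' => std_basis k (fcons s J (lift (lift ord0 i) i')))
  = ext_prepend s (incr_lift J i).
Proof.
apply: eq_wedge => i'; congr std_basis.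
have [x ->|->] := unliftP ord0 i'.
  rewrite fconsS /= ffunE -(fconsS s J); congr fcons.
  by apply: val_inj; rewrite /= /bump /=; case: leqP; case: leqP; lia.
have -> : lift (lift ord0 i) ord0 = ord0 by exact: val_inj.
by rewrite !fcons0.
Qed.

Lemma below_lift q s (J : incr q.+1 n) (i : 'I_q.+1) : below s J -> below s (incr_lift J i).
Proof. by move=> /forallP sJ; apply/forallP=> x; rewrite /= ffunE. Qed.

Lemma below_incr q s (J : incr q.+1 n) : below s J = (s < J ord0)%N.
Proof.
apply/forallP/idP => [->//|sJ i]; apply: leq_trans sJ _.
have [x ->|->//] := unliftP ord0 i.
by apply/ltnW/incr_lt.
Qed.

Lemma small_before_add al s j : (s <= j)%N ->
  small_before s (al + U_(j) *+ p) = small_before s al.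
Proof.
move=> sj; apply: eq_forallb => i; case: (ltnP i s) => //= lis.
rewrite mnmDE mulmnE mnm1E; case: eqP => [ij|_]; last by rewrite mul0n addn0.
by move: (leq_trans lis sj); rewrite ij ltnn.
Qed.

Lemma first_large_add al s j : (s < j)%N -> first_large s (al + U_(j) *+ p) = first_large s al.
Proof.
move=> sj; rewrite /first_large (small_before_add _ (ltnW sj)) mnmDE mulmnE mnm1E.
by case: eqP => [js|_]; [move: sj; rewrite js ltnn|rewrite mul0n addn0].
Qed.

Lemma first_large_le a s al : mdeg al = a -> first_large s al -> (p <= a)%N.
Proof. by move=> <- /andP [ps _]; apply: leq_trans ps _; rewrite mdegE (bigD1 s) ?leq_addr. Qed.

Lemma subK_first s al : first_large s al -> (al - U_(s) *+ p + U_(s) *+ p)%MM = al.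
Proof.
case/andP=> ps _; apply/mnmP=> i; rewrite mnmDE mnmBE mulmnE mnm1E.
by case: eqP => [<-|_]; rewrite ?mul1n ?subnK // mul0n subn0 addn0.
Qed.

Lemma mdeg_sub_first a c s al : mdeg al = a -> first_large s al -> a = (c + p)%N ->
  mdeg (al - U_(s) *+ p) = c.
Proof.
move=> ala fl ac; have := congr1 mdeg (subK_first fl).
by rewrite mdegD mdegMn mdeg1 mul1n ala ac => /eqP; rewrite eqn_add2r => /eqP.
Qed.

(* The homotopy goes from degree a to degree c = a - p. When a < p no monomial can be
   divided by a p-th power and the homotopy is zero, whatever c is; hence the implication
   in the last hypothesis. *)
Section Steps.
Variables (a b c : nat) (al : 'X_{1..n}).
Hypotheses (ala : mdeg al = a) (ab : b = (a + p)%N) (ac : (p <= a)%N -> a = (c + p)%N).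

Let acs s : first_large s al -> a = (c + p)%N.
Proof. by move=> fl; apply/ac/(first_large_le ala fl). Qed.

Lemma mdeg_add_pow j : mdeg (al + U_(j) *+ p) = b.
Proof. by rewrite mdegD mdegMn mdeg1 mul1n ala ab. Qed.

Lemma div_mul_lt s j : (s < j)%N ->
  div_pow a s (mul_pow p b j (mono k a al)) = mul_pow p a j (div_pow c s (mono k a al)).
Proof.
move=> sj; rewrite mul_pow_mono // !div_pow_mono ?mdeg_add_pow // first_large_add //.
case: ifP => fl; last by rewrite /mul_pow mulr0 linear0.
rewrite (mul_pow_mono _ (mdeg_sub_first ala fl (acs fl)) (acs fl)); congr mono.
apply/mnmP=> i; rewrite !(mnmDE, mnmBE, mulmnE, mnm1E).
case: (altP (s =P i)) => [<-|_]; last by rewrite !mul0n !subn0.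
by rewrite (_ : j == s = false) ?mul0n ?addn0 //; apply/eqP=> js; rewrite js ltnn in sj.
Qed.

Lemma div_mul_gt s j : (j < s)%N -> div_pow a s (mul_pow p b j (mono k a al)) = 0.
Proof.
move=> js; rewrite mul_pow_mono // div_pow_mono ?mdeg_add_pow //.
case: ifP => // /andP [_ /forallP /(_ j)]; rewrite js /= mnmDE mulmnE mnm1E eqxx mul1n.
by rewrite ltnNge leq_addl.
Qed.

Lemma div_mul_eq j :
  div_pow a j (mul_pow p b j (mono k a al)) = if small_before j al then mono k a al else 0.
Proof.
rewrite mul_pow_mono // div_pow_mono ?mdeg_add_pow //.
rewrite /first_large small_before_add // mnmDE mulmnE mnm1E eqxx mul1n leq_addl /=.
by rewrite addmK.
Qed.

Lemma mul_div s :
  mul_pow p a s (div_pow c s (mono k a al)) = if first_large s al then mono k a al else 0.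
Proof.
rewrite div_pow_mono //; case: ifP => fl; last by rewrite /mul_pow mulr0 linear0.
by rewrite (mul_pow_mono _ (mdeg_sub_first ala fl (acs fl)) (acs fl)) subK_first.
Qed.

(** Among the indices before j, either none has an exponent at least p or exactly
   one is the least such. *)
Lemma sum_first_large j :
  \sum_(s : 'I_n | (s < j)%N) (if first_large s al then mono k a al else 0)
  + (if small_before j al then mono k a al else 0) = mono k a al.
Proof.
rewrite -big_mkcondr /=.
case: (boolP (small_before j al)) => [/forallP sb|].
  rewrite big1 ?add0r // => s /andP [sj /andP [ps _]].
  by have := sb s; rewrite sj /= ltnNge ps.
rewrite negb_forall => /existsP [i0]; rewrite negb_imply -leqNgt => i0P.
have [i /andP [ij pi] mini] :=
  @arg_minnP _ i0 (fun i : 'I_n => (i < j)%N && (p <= al i)%N) val i0P.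
have fl : first_large i al.
  rewrite /first_large pi; apply/forallP=> x; apply/implyP=> xi.
  rewrite ltnNge; apply/negP=> px.
  by have := mini x; rewrite (ltn_trans xi ij) px /= leqNgt xi => /(_ isT).
rewrite (bigD1 i) ?ij //= big1 ?addr0 // => s /andP [/andP [sj /andP [ps /forallP sbs]] si].
have := mini s; rewrite sj ps => /(_ isT); rewrite leq_eqVlt => /orP [/eqP eq_is|lt_is].
  by move: si; rewrite (_ : s = i) ?eqxx //; apply: val_inj.
by have := sbs i; rewrite lt_is /= ltnNge pi.
Qed.

End Steps.

(** On e^al (x) e_J the terms of h o phi that lose an index of J and gain s < J_0 cancel
   against those of phi o h, in which these two steps occur in the other order. If some
   s < J_0 has al_s >= p, what is left is phi returning the s that h moved into the
   exterior factor; otherwise it is h returning the J_0 that phi moved out of it. *)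
Lemma koszul_htpy_id a b c q : b = (a + p)%N -> ((p <= a)%N -> a = (c + p)%N) ->
  (phi c a q.+1 \o koszul_htpy a c q.+1)%VF + (koszul_htpy b a q \o phi a b q)%VF
  = \1%VF.
Proof.
move=> ab ac; apply: eq_mono_ext => al J ala.
rewrite add_lfunE !comp_lfunE id_lfunE koszul_htpyE /=.
set f := mono k a al.
pose X s i := tens (mul_pow p a (J i) (div_pow c s f)) (ext_prepend s (incr_lift J i)).
have phih s : phi c a q.+1 (tens (div_pow c s f) (ext_prepend s J))
  = tens (if first_large s al then f else 0) (ext_basis k J)
    - \sum_(i < q.+1) (-1) ^+ i *: X s i.
  rewrite phi_wedge big_ord_recl /= expr0 scale1r fcons0 mul_pform_std mul_div //.
  congr (tens _ _ + _); first by apply: eq_wedge => i'; rewrite fconsS.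
  rewrite -sumrN; apply: eq_bigr => i _.
  rewrite fconsS mul_pform_std ext_prepend_lift -scaleNr; congr (_ *: _).
  by rewrite /= exprS mulN1r.
have hphi i : koszul_htpy b a q (tens (mul_pow p b (J i) f)
                  (wedge (fun i' => std_basis k (J (lift i i')))))
  = \sum_(s | below s J) X s i + (if i == ord0 then
       tens (if small_before (J ord0) al then f else 0) (ext_basis k J) else 0).
  rewrite ext_basis_lift koszul_htpyE.
  pose E := tens (if small_before (J ord0) al then f else 0) (ext_basis k J).
  have -> : (if i == ord0 then E else 0) = \sum_(s | (i == ord0) && (s == J ord0)) E.
    by case: eqP => _ /=; rewrite ?big_pred1_eq // big_pred0.
  rewrite big_mkcond [X in _ = X + _]big_mkcond [X in _ = _ + X]big_mkcond -big_split.
  apply: eq_bigr => s _ /=.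
  (* s < J_0 gives the common terms; s = J_0 contributes E, for i = 0 only; there is
     nothing for s > J_0, as then s is not below J without i or is not the least index. *)
  have J0i : (J ord0 <= J i)%N by have [x ->|->//] := unliftP ord0 i; apply/ltnW/incr_lt.
  rewrite below_incr; case: ltngtP => [sJ0|J0s|/val_inj sJ0].
  - have -> : (i == ord0) && (s == J ord0) = false.
      by apply/negP => /andP [_ /eqP sE]; rewrite sE ltnn in sJ0.
    rewrite below_lift ?below_incr // addr0.
    by rewrite /X (@div_mul_lt a b c) ?(leq_trans sJ0).
  - have -> : (i == ord0) && (s == J ord0) = false.
      by apply/negP => /andP [_ /eqP sE]; rewrite sE ltnn in J0s.
    rewrite addr0; case: ifP => // /forallP sJ.
    have [|i0] := eqVneq i ord0; first by move=> ->; rewrite (@div_mul_gt a b) // tens0l.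
    have [x ix] : exists x, lift i x = ord0.
      by case: (unliftP i ord0) i0 => [x ->|->]; [exists x|rewrite eqxx].
    by have := sJ x; rewrite /= ffunE ix ltnNge ltnW.
  rewrite sJ0 eqxx andbT add0r; have [i0|i0] := eqVneq i ord0.
    rewrite ifT; last first.
      by apply/forallP=> x; rewrite /= ffunE i0; apply: incr_lt.
    rewrite i0 (@div_mul_eq a b) //; congr (tens _ _); apply: eq_wedge => x; congr std_basis.
    by have [y ->|->] := unliftP ord0 x; rewrite ?fcons0 // fconsS /= ffunE.
  case: ifP => // /forallP sJ.
  have [x ix] : exists x, lift i x = ord0.
    by case: (unliftP i ord0) i0 => [x ->|->]; [exists x|rewrite eqxx].
  by have := sJ x; rewrite /= ffunE ix ltnn.
rewrite linear_sum (eq_bigr _ (fun s _ => phih s)) phi_wedge linear_sum.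
under [X in _ + X]eq_bigr => i _ do rewrite linearZ /= mul_pform_std hphi scalerDr.
rewrite !big_split /= sumrN exchange_big /= -addrA.
under [X in _ + (_ + (X + _))]eq_bigr => i _ do rewrite scaler_sumr.
rewrite addKr big_ord_recl [X in _ + (_ + X)]big1 ?addr0 => [|i _]; last first.
  by rewrite eq_sym (negPf (neq_lift _ _)) scaler0.
rewrite /= expr0 scale1r -[f in RHS](sum_first_large a al (J ord0)) tensDl.
congr (_ + _).
rewrite [RHS](big_morph (fun u => tens u _) (fun u v => tensDl u v _) (tens0l _ _)).
by apply: eq_bigl => s; rewrite below_incr.
Qed.

End Homotopy.

(** * Words and their symmetrization *)

Section Symmetrization.
Variables (k : fieldType) (l n : nat).
Implicit Types (w u : {ffun 'I_l -> 'I_n}) (al : 'X_{1..n}).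

Definition content w : 'X_{1..n} := [multinom count_mem j (codom w) | j < n].

Definition symmetrize w : tpow k l n := \sum_(s : 'S_l) tpow_perm s (tbasis k w).

Lemma mdeg_content w : mdeg (content w) = l.
Proof.
rewrite mdegE; under eq_bigr => j _ do rewrite mnmE.
by rewrite sum_count_mem count_predT size_codom card_ord.
Qed.

Lemma content_exists al : mdeg al = l -> exists w, content w = al.
Proof.
move=> all; pose wd := flatten [seq nseq (al j) j | j <- enum 'I_n].
have cnt (P : pred 'I_n) : count P wd = (\sum_(j | P j) al j)%N.
  rewrite count_flatten -map_comp sumnE big_map big_enum [RHS]big_mkcond.
  by apply: eq_bigr => j _; rewrite /= count_nseq; case: (P j); rewrite ?mul1n.
have sz : size wd == l by rewrite -count_predT cnt -mdegE all.
exists [ffun i => tnth (Tuple sz) i]; apply/mnmP=> j.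
rewrite mnmE (_ : codom _ = wd); first by rewrite cnt big_pred1_eq.
rewrite /codom /image_mem -[RHS](map_tnth_enum (Tuple sz)); apply: eq_map => i.
by rewrite ffunE.
Qed.

Lemma content_sum w : content w = (\sum_i U_(w i))%MM.
Proof.
apply/mnmP=> j; rewrite mnmE mnm_sumE.
rewrite -sum1_count codomE big_map enumT big_mkcond; apply: eq_bigr => i _.
by rewrite mnm1E /=; case: eqP.
Qed.

Lemma mpolyX_content w : 'X_[content w] = \prod_i 'X_(w i) :> {mpoly k[n]}.
Proof.
by rewrite -(big_morph (fun m => 'X_[m]) (@mpolyXD n k) (mpolyX0 n k)) content_sum.
Qed.

Lemma vsym_content w : vsym k l (content w) = symmetrize w.
Proof.
have aw j : content w j = count_mem j (codom w) by rewrite mnmE.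
have [s0 s0E] := monomial_tensor_word k aw.
rewrite /vsym s0E [RHS](reindex_inj (mulIg s0)) /=; apply: eq_bigr => s _.
rewrite /tbasis !tpow_perm_tprod; apply/ffunP=> u; rewrite !ffunE.
by apply: eq_bigr => i _; rewrite permM.
Qed.

Definition word_perm w (s : 'S_l) : {ffun 'I_l -> 'I_n} := [ffun i => w (s i)].

Lemma symmetrizeE w u : symmetrize w u = #|[set s | word_perm w s == u]|%:R.
Proof.
rewrite /symmetrize sum_ffunE -sum1_card natr_sum [RHS]big_mkcond; apply: eq_bigr => s _.
rewrite tpow_perm_tprod -[tprod _](_ : tbasis k (word_perm w s) = _); last first.
  by apply/ffunP=> x; rewrite !ffunE; apply: eq_bigr => i _; rewrite ffunE.
by rewrite tbasisE ffunE inE eq_sym; case: eqP.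
Qed.

Lemma word_perm1 w : word_perm w 1 = w.
Proof. by apply/ffunP=> i; rewrite ffunE perm1. Qed.

Lemma word_permM w s t : word_perm w (s * t) = word_perm (word_perm w t) s.
Proof. by apply/ffunP=> i; rewrite !ffunE permM. Qed.

Lemma content_perm w s : content (word_perm w s) = content w.
Proof.
rewrite !content_sum [RHS](reindex_inj (@perm_inj _ s)).
by apply: eq_bigr => i _; rewrite ffunE.
Qed.

Definition stab w : {set 'S_l} := [set s | word_perm w s == w].

Lemma stab_group_set w : group_set (stab w).
Proof.
apply/group_setP; split=> [|s t].
  by rewrite inE word_perm1.
by rewrite !inE word_permM => /eqP sw /eqP ->; apply/eqP.
Qed.
Canonical stab_group w := Group (stab_group_set w).

Lemma symmetrize_stab w : symmetrize w w = #|stab w|%:R.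
Proof. exact: symmetrizeE. Qed.

(** The permutations carrying w to another word form a coset of the stabilizer of w. *)
Lemma symmetrize_eq0 w : #|stab w|%:R = 0 :> k -> symmetrize w = 0.
Proof.
move=> w0; apply/ffunP=> u; rewrite symmetrizeE ffunE.
have [->|[s]] := set_0Vmem [set s | word_perm w s == u]; first by rewrite cards0.
rewrite inE => /eqP su; rewrite -[RHS]w0 -(card_lcoset (stab w) s).
suff -> : [set t | word_perm w t == u] = (s *: stab w)%g by [].
apply/setP=> t; rewrite mem_lcoset !inE word_permM.
apply/eqP/eqP=> [tu|E].
  by rewrite tu -su -word_permM mulVg word_perm1.
by rewrite -su -[in RHS]E -word_permM mulgV word_perm1.
Qed.

Lemma card_preim_content w j : #|[set i | w i == j]| = content w j.
Proof.
rewrite content_sum mnm_sumE -sum1_card big_mkcond; apply: eq_bigr => i _.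
by rewrite inE mnm1E; case: eqP.
Qed.

Lemma Sym_stab w j : perm.Sym [set i | w i == j] \subset stab w.
Proof.
apply/subsetP=> s; rewrite !inE => sS; apply/eqP/ffunP=> i; rewrite ffunE.
have := perm_closed i sS; rewrite !inE; have [-> /eqP //|wij _] := eqVneq (w i) j.
by rewrite (out_perm sS) // inE.
Qed.

(** The order of the stabilizer is the product of the factorials of the multiplicities,
   but only its divisibility by p matters. The symmetric group of a block of at least p equal
   letters is a subgroup of order divisible by p; conversely an element of order p of the
   stabilizer has an orbit with p elements, all carrying the same letter. *)
Lemma dvdn_stab p w : prime p ->
  ((p %| #|stab w|) = [exists j, p <= content w j])%N.
Proof.
move=> pr_p; apply/idP/existsP => [pst|[j pj]]; last first.
  apply: (@dvdn_trans #|perm.Sym [set i | w i == j]|); last exact/cardSg/Sym_stab.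
  by rewrite card_Sym card_preim_content dvdn_fact // prime_gt0.
have [s ss ps] := Cauchy pr_p pst.
have [i si] : exists i, s i != i.
  apply/existsP; apply: contraTT (prime_gt1 pr_p) => /existsPn s1.
  rewrite -ps (_ : s = 1%g) ?order1 //; apply/permP=> i; rewrite perm1.
  by apply/eqP/negPn/s1.
exists (w i); rewrite -card_preim_content.
have orb : porbit s i \subset [set x | w x == w i].
  apply/subsetP=> _ /porbitP [m ->]; rewrite inE.
  have : (s ^+ m)%g \in stab_group w by rewrite groupX.
  by rewrite inE => /eqP /ffunP /(_ i) <-; rewrite ffunE.
apply: leq_trans (subset_leq_card orb); move: (primeP pr_p) => [_ /(_ #|porbit s i|)].
rewrite {1}porbitE -{1}ps dvdn_orbit => /(_ isT) /orP [/cards1P [x sx]|/eqP -> //].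
have := porbit_id s i; have := mem_porbit s 1 i; rewrite expg1 sx !inE => /eqP six /eqP ix.
by rewrite six -ix eqxx in si.
Qed.

End Symmetrization.

(** * Symmetric tensors as a quotient of the symmetric power *)

Section SymToT.
Variables (k : fieldType) (n l : nat).
Local Notation quo := (sym_to_T k n l).

Lemma sym_to_T_mono al : mdeg al = l -> vsval (quo (mono k l al)) = vsym k l al.
Proof.
move=> all; rewrite [LHS]sym_to_TE.
have lt_al : (mdeg al < l.+1)%N by rewrite all.
have alI : mdeg (val (BMultinom lt_al)) == l by rewrite /= all.
rewrite (bigD1 (BMultinom lt_al)) // big1 => [|be /andP [_ be_al]].
  by rewrite -[val (BMultinom lt_al)]/al monoE // mcoeffX eqxx scale1r /= addr0.
rewrite monoE // mcoeffX eq_sym -[al]/(val (BMultinom lt_al)) (inj_eq val_inj).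
by rewrite (negPf be_al) scale0r.
Qed.

Lemma sym_to_T_content (w : {ffun 'I_l -> 'I_n}) :
  vsval (quo (mono k l (content w))) = symmetrize k w.
Proof. by rewrite sym_to_T_mono ?mdeg_content // vsym_content. Qed.

Lemma symmetrize_sum (I : finType) (c : I -> k) (w : I -> {ffun 'I_l -> 'I_n}) :
  \sum_(s : 'S_l) tpow_perm s (\sum_i c i *: tbasis k (w i))
  = \sum_i c i *: symmetrize k (w i).
Proof.
under eq_bigr => s _ do rewrite (linear_sumZ _ _ _ _ (@tpow_perm_linear k l n s)).
by rewrite exchange_big; apply: eq_bigr => i _; rewrite scaler_sumr.
Qed.

(** The monomial with content w is the product of the e_(w i). Applying g expands it over
   all words u, with the product of the g_(u i, w i) as coefficient; the same expansion
   holds for the tensor of w, and symmetrization commutes with g. *)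
Lemma sym_to_T_equivariant : equivariant quo.
Proof.
move=> g gu; apply: eq_mono => al /content_exists [w <-].
pose c (u : {ffun 'I_l -> 'I_n}) : k := \prod_i g (u i) (w i).
have gmono : sym_act l (std k n) g (mono k l (content w))
    = \sum_u c u *: mono k l (content u) :> sympow k n l.
  apply: val_inj; rewrite [LHS]sym_actE [RHS]sympoly_sum monoE ?mdeg_content //.
  rewrite mpolyX_content rmorph_prod /=.
  under eq_bigr => i _ do rewrite comp_mpolyXU -tnth_nth tnth_mktuple.
  rewrite bigA_distr_bigA; apply: eq_bigr => u _.
  rewrite scaler_prod -mpolyX_content.
  by rewrite -[RHS]/(c u *: (mono k l (content u) : {mpoly k[n]})) monoE ?mdeg_content.
apply: val_inj; rewrite !comp_lfunE gmono linear_sum.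
rewrite -[LHS]/(vsval _) -[RHS]/(vsval _) linear_sum.
transitivity (\sum_u c u *: symmetrize k u).
  by apply: eq_bigr => u _; rewrite !linearZ; congr (_ *: _); apply: sym_to_T_content.
rewrite [RHS]sub_actE; last exact: T_stable.
transitivity (tpow_act l (std k n) g (symmetrize k w)); last first.
  by apply: congr1; rewrite -sym_to_T_content.
rewrite [RHS]linear_sum.
have E s : tpow_act l (std k n) g (tpow_perm s (tbasis k w))
    = tpow_perm s (\sum_u c u *: tbasis k u).
  transitivity (tpow_perm s (tprod (fun i => g *m std_basis k (w i)))).
    by rewrite /tbasis !tpow_perm_tprod tpow_act_tprod.
  congr tpow_perm.
  rewrite [LHS]ffun_sum_delta; apply: eq_bigr => u _; rewrite tbasisE ffunE.
  by congr (_ *: _); apply: eq_bigr => i _; rewrite mulmx_std_basis.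
by rewrite [RHS](eq_bigr _ (fun s _ => E s)) symmetrize_sum.
Qed.

Lemma sym_to_T_surj : limg quo = fullv.
Proof.
apply/vspaceP=> t; rewrite memvf.
pose val_fun : 'Hom(T k n l, tpow k l n) := linfun (fun x : subvs_of _ => vsval x).
have : (Tspace k l n <= val_fun @: limg quo)%VS.
  apply/span_subvP=> _ /imageP [al /eqP all ->].
  apply/memv_imgP; exists (quo (mono k l (val al))).
    exact/memv_img/memvf.
  by rewrite lfunE /= sym_to_T_mono.
move=> /subvP /(_ _ (subvsP t)) /memv_imgP [y yq].
by rewrite lfunE => /val_inj ->.
Qed.

Variables (p : nat) (charkp : p \in [pchar k]).

Lemma sym_to_T_large al j : mdeg al = l -> (p <= al j)%N -> quo (mono k l al) = 0.
Proof.
move=> /content_exists [w <-] pj; apply: val_inj; rewrite -[LHS]/(vsval _) sym_to_T_content.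
apply/symmetrize_eq0/eqP; rewrite -(dvdn_pcharf charkp) dvdn_stab ?(pcharf_prime charkp) //.
by apply/existsP; exists j.
Qed.

Lemma sym_to_T_at w al : mdeg al = l ->
  (vsval (quo (mono k l al)) : tpow k l n) w = if al == content w then #|stab w|%:R else 0.
Proof.
have [->|al_w] := eqVneq al (content w); first by rewrite sym_to_T_content symmetrize_stab.
case/content_exists=> u uE; rewrite -uE sym_to_T_content symmetrizeE.
rewrite (_ : [set s | _] = set0) ?cards0 //; apply/setP=> s; rewrite !inE.
by apply: contraNF al_w => /eqP uw; rewrite -uE -uw content_perm.
Qed.

(** On a word with content al the tensor v(al) has the order of the stabilizer as
   coordinate, which is prime to p, and all other v(be) vanish. *)
Lemma sym_to_T_ker f al : quo f = 0 -> mdeg al = l -> (forall j, al j < p)%N -> f@_al = 0.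
Proof.
move=> f0 all small; have [w wE] := content_exists all.
pose ev (h : sympow k n l) : k^o := (vsval (quo h) : tpow k l n) w.
have ev_linear : linear ev by move=> c x y; rewrite /ev !linearP !ffunE.
have : ev f = 0 by rewrite /ev f0 ffunE.
have lt_al : (mdeg al < l.+1)%N by rewrite all.
have alI : mdeg (val (BMultinom lt_al)) == l by rewrite /= all.
pose i0 : {al : 'X_{1..n < l.+1} | mdeg (val al) == l} := exist _ (BMultinom lt_al) alI.
rewrite {1}(mono_expand f) (linear_sumZ _ _ _ _ ev_linear) (bigD1 i0) // big1 => [|i ii0].
  rewrite /ev sym_to_T_at // wE eqxx /= addr0 => /eqP.
  rewrite mulf_eq0 -(dvdn_pcharf charkp) dvdn_stab ?(pcharf_prime charkp) //.
  by case/orP => [/eqP //|/existsP [j]]; rewrite wE leqNgt small.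
rewrite /ev sym_to_T_at ?(eqP (valP i)) // wE ifF ?scaler0 //.
by apply: contraNF ii0 => /eqP uw; apply/eqP/val_inj/val_inj.
Qed.

End SymToT.

(** * Exactness of the complex *)

Lemma equivariant_comp (k : fieldType) n (U V W : rep k n) (f : 'Hom(U, V)) (h : 'Hom(V, W)) :
  equivariant f -> equivariant h -> equivariant (h \o f)%VF.
Proof. by move=> fE hE g gu; rewrite -comp_lfunA fE // !comp_lfunA hE. Qed.

Section KoszulExact.
Variables (k : fieldType) (n p : nat) (charkp : p \in [pchar k]).
Local Notation phi := (koszul_phi n charkp).
Local Notation quo l := (sym_to_T k n l).
Local Notation unit l := (koszul_unit n charkp l).

Lemma koszul_htpy_small a c q : (a < p)%N -> koszul_htpy n charkp a c q = 0 :> 'Hom(_, _).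
Proof.
move=> ap; apply: eq_mono_ext => al J ala; rewrite zero_lfunE koszul_htpyE.
rewrite big1 // => s _; rewrite div_pow_mono // ifF ?tens0l //.
by apply/negP => /(first_large_le ala); rewrite leqNgt ap.
Qed.

(** This is the left end of the complex: in degree less than p the homotopy has nothing to
   divide, so that it is a left inverse of the next differential. *)
Lemma phi_inj a b q : (a < p)%N -> b = (a + p)%N -> lker (phi a b q) = 0%VS.
Proof.
move=> ap ab; have ac : (p <= a)%N -> a = (0 + p)%N by rewrite leqNgt ap.
have := koszul_htpy_id n charkp q ab ac; rewrite koszul_htpy_small // comp_lfun0r add0r => hphi.
apply/eqP/lker0P => s t st.
by rewrite -[s]id_lfunE -[t]id_lfunE -hphi !comp_lfunE st.
Qed.

Lemma phi_exact a b c q : a = (c + p)%N -> b = (a + p)%N ->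
  limg (phi c a q.+1) = lker (phi a b q).
Proof.
move=> ac ab; apply/vspaceP=> t; rewrite memv_ker; apply/memv_imgP/eqP => [[s _ ->]|t0].
  by rewrite -comp_lfunE phi_phi // zero_lfunE.
exists (koszul_htpy n charkp a c q.+1 t); first exact: memvf.
have := congr1 (fun h : 'End(_) => h t) (koszul_htpy_id n charkp q ab (fun _ => ac)).
by rewrite add_lfunE !comp_lfunE t0 linear0 addr0 id_lfunE.
Qed.

Lemma incr0_unique : exists J0 : incr 0 n, forall J, J = J0.
Proof.
have f0P : [forall i : 'I_0, forall j : 'I_0, (i < j)%N ==>
   ((ffun0 (card_ord 0) : {ffun 'I_0 -> 'I_n}) i < (ffun0 (card_ord 0) : {ffun 'I_0 -> 'I_n}) j)%N].
  by apply/forallP; case.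
by exists (Incr f0P) => J; apply: incr_sub; case.
Qed.

Lemma unit_wedge l (f : sympow k n l) (v : 'I_0 -> 'cV[k]_n) : unit l (tens f (wedge v)) = f.
Proof.
have [J0 J0P] := incr0_unique.
have sum_J0 (x : ext k 0 n) (u : sympow k n l) :
    \sum_(J : incr 0 n) (x J : k) *: u = (x J0 : k) *: u.
  by rewrite (bigD1 J0) //= big1 ?addr0 // => J; rewrite (J0P J) eqxx.
rewrite tens_liftE => [|u c x y|x c u u'].
- by rewrite sum_J0 ffunE det_mx00 scale1r.
- by rewrite !sum_J0 !ffunE scalerDl scalerA.
by rewrite !sum_J0 scalerDr !scalerA mulrC.
Qed.

Lemma unit_inj l : lker (unit l) = 0%VS.
Proof.
have [J0 J0P] := incr0_unique.
have line (x : ext k 0 n) : exists c, x = c *: ext_basis k J0.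
  exists (x J0); rewrite {1}(ext_basis_expand x) (bigD1 J0) //= big1 ?addr0 // => J.
  by rewrite (J0P J) eqxx.
apply/eqP; rewrite -subv0; apply/subvP=> t; rewrite memv_ker memv0 => /eqP.
have [u ->] := tens_line line t.
by rewrite unit_wedge => ->; rewrite tens0l.
Qed.

Lemma unit_equivariant l : equivariant (unit l).
Proof.
move=> g gu; apply: eq_tens_wedge => f v.
by rewrite [LHS]comp_lfunE [RHS]comp_lfunE [in LHS]koszul_act_wedge !unit_wedge.
Qed.

Lemma unit_phi_equivariant a l : l = (a + p)%N -> equivariant (unit l \o phi a l 0)%VF.
Proof.
by move=> la; exact: equivariant_comp (phi_equivariant charkp 0 la) (@unit_equivariant l).
Qed.

Lemma unit_phi_ker a l : lker (unit l \o phi a l 0)%VF = lker (phi a l 0).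
Proof.
by apply/vspaceP=> t; rewrite !memv_ker comp_lfunE -[unit l _ == 0]memv_ker unit_inj memv0.
Qed.

Lemma unit_phi_mono a l j (v : 'I_1 -> 'cV[k]_n) al : mdeg al = a -> l = (a + p)%N ->
  v ord0 = std_basis k j ->
  unit l (phi a l 0 (tens (mono k a al) (wedge v))) = mono k l (al + U_(j) *+ p).
Proof.
move=> ala al' vj; rewrite phi_wedge big_ord1 linearZ /= unit_wedge expr0 scale1r.
by rewrite vj mul_pform_std mul_pow_mono.
Qed.

(** The kernel of the map to T^l(V) and the image of phi are both the degree l part of the
   ideal (e_1^p, ..., e_n^p): v(al) vanishes exactly when e^al lies in that ideal, and
   the remaining v(al) are independent. *)
Lemma unit_phi_exact a l : l = (a + p)%N ->
  limg (unit l \o phi a l 0)%VF = lker (quo l).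
Proof.
move=> lE; apply/vspaceP=> f; rewrite memv_ker; apply/idP/eqP.
  move=> /memv_imgP [t _ ->]; rewrite -comp_lfunE.
  suff -> : (quo l \o (unit l \o phi a l 0))%VF = 0 by rewrite zero_lfunE.
  apply: eq_mono_ext => al J ala; rewrite zero_lfunE !comp_lfunE.
  rewrite (unit_phi_mono (j := J ord0)) // (sym_to_T_large charkp (j := J ord0)) //.
    by rewrite mdegD mdegMn mdeg1 mul1n ala.
  by rewrite mnmDE mulmnE mnm1E eqxx mul1n leq_addl.
move=> f0; rewrite (mono_expand f); apply: rpred_sum => i _.
set al := val (val i); have all : mdeg al = l := eqP (valP i).
have [/forallP small|] := boolP [forall j, al j < p]%N.
  by rewrite (sym_to_T_ker charkp) // scale0r rpred0.
rewrite negb_forall => /existsP [j]; rewrite -leqNgt => pj; apply: rpredZ.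
have alK : (al - U_(j) *+ p + U_(j) *+ p)%MM = al.
  apply: submK; apply/mnm_lepP => i'; rewrite mulmnE mnm1E.
  by case: eqP => [<-|_]; rewrite ?mul1n // mul0n.
have dal : mdeg (al - U_(j) *+ p) = a.
  have := congr1 mdeg alK; rewrite mdegD mdegMn mdeg1 mul1n all lE => /eqP.
  by rewrite eqn_add2r => /eqP.
rewrite -alK -(@unit_phi_mono a l j (fun=> std_basis k j)) // -comp_lfunE.
exact/memv_img/memvf.
Qed.

Lemma koszul_exact l lp : (lp * p <= l < lp.+1 * p)%N ->
  exact_sequence (koszul_seq n charkp l) (koszul_map n charkp l) lp.
Proof.
case/andP=> lpl llp.
have deg q : (q < lp)%N -> (l - q * p)%N = (l - q.+1 * p + p)%N.
  move=> qlp; have : (q.+1 * p <= l)%N by apply: leq_trans lpl; rewrite leq_mul2r qlp orbT.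
  by rewrite mulSn; lia.
have deg1 : (0 < lp)%N -> l = (l - 1 * p + p)%N by move=> /deg; rewrite mul0n subn0.
have last_small : (l - lp * p < p)%N by move: llp; rewrite mulSn; lia.
split.
- case=> [|[|q]] qlp; first exact: sym_to_T_equivariant.
    exact/unit_phi_equivariant/deg1.
  exact/phi_equivariant/deg.
- case: lp lpl llp deg deg1 last_small => [|[|lp]] lpl llp deg deg1 last_small.
  + rewrite mul0n subn0 in last_small; apply/eqP; rewrite -subv0; apply/subvP=> f.
    rewrite memv_ker memv0 => /eqP f0; rewrite (mono_expand f) big1 // => i _.
    rewrite (sym_to_T_ker charkp f0) ?(eqP (valP i)) ?scale0r // => j.
    apply: leq_ltn_trans last_small; rewrite -[leqRHS](eqP (valP i)).
    by rewrite mdegE (bigD1 j) //= leq_addr.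
  + by rewrite unit_phi_ker phi_inj //; apply: deg1.
  exact/phi_inj/deg.
- case=> [|[|q]] qlp.
  + exact/unit_phi_exact/deg1.
  + rewrite unit_phi_ker; apply: phi_exact; last exact/deg1/ltnW.
    exact: deg.
  by apply: phi_exact; [apply: deg|apply/deg/ltnW].
exact: sym_to_T_surj.
Qed.

End KoszulExact.

(** * Powers of linear forms *)

Section LinearForms.
Variables (k : fieldType) (n : nat).

Definition linform (v : 'cV[k]_n) : {mpoly k[n]} := \sum_j v j 0 *: 'X_j.

Lemma linform_homog v : linform v \is 1.-homog.
Proof. by apply: rpred_sum => j _; apply: rpredZ; rewrite dhomogX; apply/eqP/mdeg1. Qed.

Lemma linform_exp_homog v d : linform v ^+ d \is d.-homog.
Proof. by have := dhomogMn d (linform_homog v); rewrite mul1n. Qed.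

Lemma linform_subst (g : 'M[k]_n) v : linform v \mPo lin_subst g = linform (g *m v).
Proof.
rewrite /linform [X in X \mPo _]/= linear_sum /=.
under [RHS]eq_bigr => j _ do rewrite mxE scaler_suml.
rewrite exchange_big; apply: eq_bigr => i _ /=.
rewrite linearZ /= comp_mpolyXU -tnth_nth tnth_mktuple scaler_sumr.
by apply: eq_bigr => j _; rewrite scalerA mulrC.
Qed.

End LinearForms.

Section CharacteristicP.
Variables (k : fieldType) (p : nat) (charkp : p \in [pchar k]).

Lemma natf_neq0_lt i : (0 < i < p)%N -> i%:R != 0 :> k.
Proof. by case/andP=> i0 ip; rewrite -(dvdn_pcharf charkp) gtnNdvd. Qed.

Lemma fact_neq0 m : (m < p)%N -> m`!%:R != 0 :> k.
Proof.
elim: m => [|m IHm] mp; first by rewrite oner_neq0.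
by rewrite factS natrM mulf_neq0 ?IHm ?(ltnW mp) // natf_neq0_lt.
Qed.

Lemma bin_neq0 m i : (i <= m < p)%N -> 'C(m, i)%:R != 0 :> k.
Proof.
case/andP=> im mp; have := fact_neq0 mp; rewrite -(bin_fact im) natrM.
by apply: contra => /eqP ->; rewrite mul0r.
Qed.

(** The coefficients of (1 + x)^(p-1) = (1 + x^p) / (1 + x). *)
Lemma bin_pred_prime i : (i < p)%N -> 'C(p.-1, i)%:R = (-1) ^+ i :> k.
Proof.
have pr := pcharf_prime charkp; have p0 := prime_gt0 pr.
elim: i => [|i IHi] ip; first by rewrite bin0 expr0.
have : 'C(p, i.+1)%:R = 0 :> k by rewrite (bin_lt_pcharf_0 charkp).
rewrite -{1}(prednK p0) binS natrD IHi ?(ltnW ip) // => /eqP.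
by rewrite addr_eq0 => /eqP ->; rewrite exprS mulN1r.
Qed.

End CharacteristicP.

Section TwoVariables.
Variables (k : fieldType).
Implicit Types (al be : 'X_{1..2}).

Lemma mdeg2 al : mdeg al = (al ord0 + al ord_max)%N.
Proof.
rewrite mdegE !big_ord_recl big_ord0 addn0; congr (_ + al _)%N.
exact: val_inj.
Qed.

Lemma eq_mnm2 al be : al ord0 = be ord0 -> al ord_max = be ord_max -> al = be.
Proof.
move=> e0 e1; apply/mnmP=> i.
by case: (unliftP ord0 i) => [j|] -> //; rewrite (_ : lift _ j = ord_max) // ord1; apply: val_inj.
Qed.

Definition mnm2 (a b : nat) : 'X_{1..2} := [multinom (if i == ord0 then a else b) | i < 2].

Lemma mnm2E0 a b : mnm2 a b ord0 = a. Proof. by rewrite mnmE. Qed.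
Lemma mnm2E1 a b : mnm2 a b ord_max = b. Proof. by rewrite mnmE. Qed.

Lemma mdeg_mnm2 a b : mdeg (mnm2 a b) = (a + b)%N.
Proof. by rewrite mdeg2 mnm2E0 mnm2E1. Qed.

Lemma linform2_exp (v : 'cV[k]_2) N :
  linform v ^+ N = \sum_(i < N.+1)
    ('C(N, i)%:R * v ord0 0 ^+ (N - i) * v ord_max 0 ^+ i) *: 'X_[mnm2 (N - i) i].
Proof.
have -> : linform v = v ord0 0 *: 'X_ord0 + v ord_max 0 *: 'X_ord_max.
  rewrite /linform !big_ord_recl big_ord0 addr0; congr (_ + v _ 0 *: 'X_ _); exact: val_inj.
rewrite exprDn; apply: eq_bigr => i _.
rewrite !exprZn -scalerAl -scalerAr scalerA -scaler_nat scalerA mulrA; congr (_ *: _).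
rewrite !mpolyXn -mpolyXD; congr 'X_[_].
by apply: eq_mnm2; rewrite mnmDE !mulmnE !mnm1E ?mnm2E0 ?mnm2E1 /= mul0n mul1n ?addn0.
Qed.

Lemma mcoeff_linform2_exp (v : 'cV[k]_2) N al : mdeg al = N ->
  (linform v ^+ N)@_al
  = 'C(N, al ord_max)%:R * v ord0 0 ^+ al ord0 * v ord_max 0 ^+ al ord_max.
Proof.
move=> alN; rewrite linform2_exp raddf_sum /=.
have lt1 : (al ord_max < N.+1)%N by rewrite -alN mdeg2 ltnS leq_addl.
have al0 : (N - al ord_max)%N = al ord0 by rewrite -alN mdeg2 addnK.
rewrite (bigD1 (Ordinal lt1)) //= big1 => [|i ine].
  rewrite mcoeffZ mcoeffX addr0 al0 (_ : mnm2 _ _ = al) ?eqxx ?mulr1 //.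
  by apply: eq_mnm2; rewrite ?mnm2E0 ?mnm2E1.
rewrite mcoeffZ mcoeffX; case: eqP => [E|_]; last by rewrite mulr0.
by case/eqP: ine; apply: val_inj; rewrite /= -E mnm2E1.
Qed.

(** For m < p the m-th powers of the linear forms X + tY span Sym^m(k^2). The
   coefficients of the m-th power are nonzero multiples of 1, t, ..., t^m, and a
   polynomial of degree m has no p roots, here the p elements of the prime field. *)
Lemma eq_powers p (charkp : p \in [pchar k]) m (Z : vectType k)
    (h h' : 'Hom(sympow k 2 m, Z)) : (m < p)%N ->
  (forall v : 'cV[k]_2, v ord0 0 = 1 ->
     h (sym_proj m (linform v ^+ m)) = h' (sym_proj m (linform v ^+ m))) -> h = h'.
Proof.
move=> mp hh.
suff D0 i : (i <= m)%N -> h (mono k m (mnm2 (m - i) i)) = h' (mono k m (mnm2 (m - i) i)).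
  apply: eq_mono => al alm; have := D0 (al ord_max).
  have -> : (m - al ord_max)%N = al ord0 by rewrite -alm mdeg2 addnK.
  have -> : (al ord_max <= m)%N by rewrite -alm mdeg2 leq_addl.
  move=> /(_ isT).
  by rewrite (_ : mnm2 _ _ = al) //; apply: eq_mnm2; rewrite ?mnm2E0 ?mnm2E1.
move=> im; apply/eqP; rewrite -subr_eq0; apply/eqP.
rewrite [LHS]vbasis_expand; apply: big1 => c _.
pose co i := coord (vbasis {:Z}) c (h (mono k m (mnm2 (m - i) i)) - h' (mono k m (mnm2 (m - i) i))).
pose P := \poly_(i < m.+1) ('C(m, i)%:R * co i).
suff P0 : P = 0.
  have := congr1 (fun Q : {poly k} => Q`_i) P0; rewrite coef_poly ltnS im coef0 => /eqP.
  have imp : (i <= m < p)%N by rewrite im.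
  rewrite mulf_eq0 (negPf (bin_neq0 charkp imp)) /= => /eqP coi.
  by rewrite -[X in X *: _]/(co i) coi scale0r.
apply: (@roots_geq_poly_eq0 _ _ [seq (i%:R : k) | i <- iota 0 p]).
- apply/allP=> _ /mapP [j _ ->]; set t := j%:R.
  pose v : 'cV[k]_2 := \col_i (if i == ord0 then 1 else t).
  have v0 : v ord0 0 = 1 by rewrite mxE.
  have vE (f : 'Hom(sympow k 2 m, Z)) : f (sym_proj m (linform v ^+ m))
     = \sum_(i < m.+1) ('C(m, i)%:R * t ^+ i) *: f (mono k m (mnm2 (m - i) i)).
    rewrite linform2_exp !linear_sum; apply: eq_bigr => r _.
    by rewrite !linearZ /= !mxE /= expr1n mulr1.
  have /eqP := hh v v0; rewrite !vE -subr_eq0 -sumrB => /eqP /(congr1 (coord (vbasis {:Z}) c)).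
  rewrite linear0 linear_sum /= => E; rewrite rootE horner_poly.
  apply/eqP; apply: etrans E.
  apply: eq_bigr => r _; rewrite -scalerBr linearZ /=.
  by rewrite mulrAC.
- rewrite map_inj_in_uniq ?iota_uniq // => x y; rewrite !mem_iota !add0n /= => xp yp.
  wlog xy : x y xp yp / (x <= y)%N.
    by move=> W; case: (leqP x y) => [|/ltnW] xy E; [|apply/esym]; apply: W.
  move/esym/eqP; rewrite -subr_eq0 -natrB // -(dvdn_pcharf charkp) => pd.
  apply/eqP; rewrite eqn_leq xy -subn_eq0.
  move: pd; case: (y - x)%N (leq_subr x y) => // z zy; rewrite gtnNdvd //.
  exact: leq_ltn_trans zy yp.
by rewrite size_map size_iota; apply: leq_trans (size_poly _ _) mp.
Qed.

End TwoVariables.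

(** * The representation T^l for n = 2 and l >= p *)

Section Duality.
Variables (k : fieldType) (p : nat) (charkp : p \in [pchar k]).
Variables (m d l : nat).
Hypotheses (pE : p = (m + d).+1) (lE : l = (m + d + d)%N).
Implicit Types (al be : 'X_{1..2}).
Local Notation quo := (sym_to_T k 2 l).
Local Notation dd := (mnm2 d d).

Lemma mdeg_shift be : mdeg be = m -> mdeg (be + dd) = l.
Proof. by move=> bem; rewrite mdegD mdeg_mnm2 bem lE addnA. Qed.

Lemma small_shift al : mdeg al = l -> (forall j, al j < p)%N ->
  exists2 be, mdeg be = m & al = (be + dd)%MM.
Proof.
rewrite mdeg2 => all small; have := small ord0; have := small ord_max.
rewrite pE => s1 s0.
have [d0 d1] : (d <= al ord0 /\ d <= al ord_max)%N by lia.
exists (mnm2 (al ord0 - d) (al ord_max - d)); first by rewrite mdeg_mnm2; lia.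
by apply: eq_mnm2; rewrite mnmDE ?(mnm2E0, mnm2E1) subnK.
Qed.

(** Only the coefficients at the exponents at most p - 1 matter in T^l, and by small_shift
   these exponents are the translates by (d, d) of the exponents of degree m. *)
Lemma eq_sym_to_T (f h : sympow k 2 l) :
  (forall be, mdeg be = m -> f@_(be + dd) = h@_(be + dd)) -> quo f = quo h.
Proof.
move=> fh; apply/eqP; rewrite -subr_eq0 -linearB; apply/eqP.
rewrite (mono_expand (f - h)) linear_sum; apply: big1 => i _; rewrite linearZ /=.
set al := val (val i); have all : mdeg al = l := eqP (valP i).
have [/forallP small|] := boolP [forall j, al j < p]%N.
  have [be bem ->] := small_shift all small.
  by rewrite mcoeffB fh // subrr scale0r.
rewrite negb_forall => /existsP [j]; rewrite -leqNgt => pj.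
by rewrite (sym_to_T_large charkp all pj) scaler0.
Qed.

(** These coefficients are forced by dual_hom_powers at w = e_2.
   The map that they define is, up to twist, the composite of the self-duality of Sym^m
   for m < p with the pairing of T^l and T^m into T^(2(p-1)), a power of det. *)
Definition dual_coef be : k := (-1) ^+ be ord_max / 'C(m, be ord_max)%:R.

Lemma dual_coef_neq0 be : mdeg be = m -> dual_coef be != 0.
Proof.
move=> bem; rewrite mulf_neq0 ?signr_eq0 // invr_eq0 (bin_neq0 charkp) //.
by rewrite -bem mdeg2 leq_addl /= -mdeg2 bem pE ltnS leq_addr.
Qed.

Definition dual_fun (f : sympow k 2 m) : sympow k 2 l :=
  \sum_(al : {al : 'X_{1..2 < l.+1} | mdeg (val al) == l})
    (f@_(val (val al) - dd) * dual_coef (val (val al) - dd)) *: mono k l (val (val al)).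

Lemma dual_fun_linear : linear dual_fun.
Proof.
move=> c f h; rewrite /dual_fun scaler_sumr -big_split; apply: eq_bigr => be _ /=.
by rewrite scalerA -scalerDl mcoeffD mcoeffZ mulrDl -mulrA.
Qed.

Lemma mcoeff_dual_fun f be : mdeg be = m -> (dual_fun f)@_(be + dd) = f@_be * dual_coef be.
Proof.
move=> bem; rewrite (mcoeff_mono_sum (fun al => f@_(al - dd) * dual_coef (al - dd))).
  by rewrite addmK.
exact: mdeg_shift.
Qed.

Definition dual_hom : 'Hom(sympow k 2 m, T k 2 l) := (quo \o linfun dual_fun)%VF.

Lemma dual_homE f : dual_hom f = quo (dual_fun f).
Proof. by rewrite comp_lfunE (linfunE dual_fun_linear). Qed.

(** The map sends v^m to v^(p-1) w^d for any w with det(v, w) = 1. The choice of w is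
   immaterial because v^p vanishes in T. The coefficients are compared: since the
   binomial coefficients of p - 1 are signs, the sum over the expansion of w^d is
   the expansion of det(v, w)^d. *)
Lemma dual_hom_powers (v w : 'cV[k]_2) :
  quo (sym_proj l (linform v ^+ (m + d) * linform w ^+ d)) =
  (v ord0 0 * w ord_max 0 - v ord_max 0 * w ord0 0) ^+ d *:
    dual_hom (sym_proj m (linform v ^+ m)).
Proof.
rewrite dual_homE -linearZ /=; apply: eq_sym_to_T => be bem.
have be1m : (be ord_max <= m)%N by rewrite -bem mdeg2 leq_addl.
rewrite sym_projE; last first.
  by rewrite lE; apply: dhomogM; apply: linform_exp_homog.
rewrite -[sympoly (_ *: _)]/(_ *: (dual_fun _ : {mpoly k[2]})) mcoeffZ mcoeff_dual_fun //.
rewrite sym_projE ?linform_exp_homog // mcoeff_linform2_exp //.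
rewrite (linform2_exp w) mulr_sumr raddf_sum /=.
pose a := v ord0 0; pose b := v ord_max 0; pose c := w ord0 0; pose e := w ord_max 0.
have coefE (s : 'I_d.+1) : (linform v ^+ (m + d) *
     (('C(d, s)%:R * c ^+ (d - s) * e ^+ s) *: 'X_[mnm2 (d - s) s]))@_(be + dd)
   = (-1) ^+ be ord_max * a ^+ be ord0 * b ^+ be ord_max
     * ('C(d, s)%:R * (- (b * c)) ^+ (d - s) * (a * e) ^+ s).
  have sd : (s <= d)%N by rewrite -ltnS.
  have -> : (be + dd = mnm2 (d - s) s + mnm2 (be ord0 + s) (be ord_max + (d - s)))%MM.
    by apply: eq_mnm2; rewrite !mnmDE ?(mnm2E0, mnm2E1); lia.
  rewrite -scalerAr mcoeffZ mcoeffMX mcoeff_linform2_exp; last first.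
    by rewrite mdeg_mnm2 -bem mdeg2; lia.
  rewrite mnm2E0 mnm2E1 -[(m + d)%N]/((m + d).+1.-1) -pE (bin_pred_prime charkp); last first.
    by rewrite pE; lia.
  rewrite -/a -/b !exprD (exprNn (b * c)) !exprMn.
  by ring.
rewrite (eq_bigr _ (fun s _ => coefE s)) -mulr_sumr.
have -> : \sum_(s < d.+1) 'C(d, s)%:R * (- (b * c)) ^+ (d - s) * (a * e) ^+ s
    = (a * e - b * c) ^+ d.
  by rewrite addrC exprDn; apply: eq_bigr => s _; rewrite -mulrA mulr_natl.
have C0 : 'C(m, be ord_max)%:R != 0 :> k by rewrite (bin_neq0 charkp) // be1m pE ltnS leq_addr.
by rewrite /dual_coef; field.
Qed.

Lemma det_row_mx2 (v w : 'cV[k]_2) :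
  \det (row_mx v w) = v ord0 0 * w ord_max 0 - v ord_max 0 * w ord0 0.
Proof.
have colv (i : 'I_2) : row_mx v w i ord0 = v i 0.
  by rewrite (_ : ord0 = lshift 1 (0 : 'I_1)) ?row_mxEl //; apply: val_inj.
have colw (i : 'I_2) : row_mx v w i ord_max = w i 0.
  by rewrite (_ : ord_max = rshift 1 (0 : 'I_1)) ?row_mxEr //; apply: val_inj.
have minor (M : 'M[k]_2) i : row' i (col' ord0 M) 0 0 = M (lift i ord0) (lift ord0 ord0).
  by rewrite !mxE.
have l0 : (lift ord0 ord0 : 'I_2) = ord_max by exact: val_inj.
have l1 : (lift ord_max ord0 : 'I_2) = ord0 by exact: val_inj.
rewrite (expand_det_col _ ord0) !big_ord_recl big_ord0 addr0 /cofactor !det_mx11.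
rewrite !minor !(l0, l1) !colv !colw /= expr0 expr1.
by rewrite mul1r mulN1r mulrN.
Qed.

(** On v^m, with v = e_1 + t e_2 and w = e_2, both sides are the image of
   (gv)^(p-1) (gw)^d, as det(gv, gw) = det g. *)
Lemma dual_hom_equivariant g f : g \in unitmx ->
  \det g ^+ d *: dual_hom (sym_act m (std k 2) g f) = act (T k 2 l) g (dual_hom f).
Proof.
move=> gu.
suff E : (\det g ^+ d *: (dual_hom \o sym_act m (std k 2) g))%VF
      = (act (T k 2 l) g \o dual_hom)%VF :> 'Hom(_, _).
  by have := congr1 (fun h : 'Hom(_, _) => h f) E; rewrite scale_lfunE !comp_lfunE.
apply: (eq_powers charkp); first by rewrite pE ltnS leq_addr.
move=> v v0; rewrite scale_lfunE [in LHS]comp_lfunE [RHS]comp_lfunE.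
pose w : 'cV[k]_2 := \col_i (i == ord_max)%:R.
have det_vw : \det (row_mx v w) = 1.
  by rewrite det_row_mx2 v0 !mxE mul1r mulr0 subr0.
have subst_exp N : sym_act N (std k 2) g (sym_proj N (linform v ^+ N))
    = sym_proj N (linform (g *m v) ^+ N).
  apply: val_inj; rewrite [LHS]sym_actE [RHS]sym_projE ?linform_exp_homog //.
  by rewrite sym_projE ?linform_exp_homog // rmorphXn /= linform_subst.
have vw_homog (x y : 'cV[k]_2) : linform x ^+ (m + d) * linform y ^+ d \is l.-homog.
  by rewrite lE; apply: dhomogM; apply: linform_exp_homog.
have act_vw : sym_act l (std k 2) g (sym_proj l (linform v ^+ (m + d) * linform w ^+ d))
    = sym_proj l (linform (g *m v) ^+ (m + d) * linform (g *m w) ^+ d).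
  apply: val_inj; rewrite [LHS]sym_actE [RHS]sym_projE // sym_projE //.
  by rewrite rmorphM !rmorphXn /= !linform_subst.
rewrite subst_exp.
have := dual_hom_powers (g *m v) (g *m w).
rewrite -det_row_mx2 -mul_mx_row det_mulmx det_vw mulr1 -act_vw => <-.
have := dual_hom_powers v w; rewrite -det_row_mx2 det_vw expr1n scale1r => <-.
have E := sym_to_T_equivariant l gu.
pose vw := sym_proj l (linform v ^+ (m + d) * linform w ^+ d).
by have := congr1 (fun h : 'Hom(_, _) => h vw) E; rewrite !comp_lfunE.
Qed.

Definition twist_map : 'Hom(tens_rep (Sym k 2 m) (col_rep (det_mxrep k 2 d)), T k 2 l) :=
  tens_lift (fun (f : sympow k 2 m) (x : 'cV[k]_1) => x 0 0 *: dual_hom f).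

Lemma twist_mapE (f : sympow k 2 m) (x : 'cV[k]_1) :
  twist_map (tens f x) = x 0 0 *: dual_hom f.
Proof.
rewrite tens_liftE // => [u c y z|y c u u'].
  by rewrite !mxE scalerDl scalerA.
by rewrite linearP scalerDr !scalerA mulrC.
Qed.

Lemma twist_map_equivariant : equivariant twist_map.
Proof.
move=> g gu; apply: eq_tens => f x; rewrite [LHS]comp_lfunE [RHS]comp_lfunE.
rewrite [in LHS]tens_homE !twist_mapE.
transitivity (x 0 0 *: act (T k 2 l) g (dual_hom f)); last by rewrite linearZ.
rewrite -dual_hom_equivariant // scalerA.
by congr (_ *: _); rewrite lfunE /= mul_scalar_mx mxE mulrC.
Qed.

Lemma dual_hom_inj : lker dual_hom = 0%VS.
Proof.
apply/eqP; rewrite -subv0; apply/subvP=> f; rewrite memv_ker dual_homE memv0 => /eqP f0.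
apply/eqP/sympow_inj => i; set be := val (val i); rewrite mcoeff0.
have bem : mdeg be = m := eqP (valP i).
have be_small j : ((be + dd)%MM j < p)%N.
  have : (be j <= m)%N by rewrite -bem mdegE (bigD1 j) //= leq_addr.
  by rewrite mnmDE mnmE if_same pE; lia.
have /eqP := sym_to_T_ker charkp f0 (mdeg_shift bem) be_small.
by rewrite mcoeff_dual_fun // mulf_eq0 (negPf (dual_coef_neq0 bem)) orbF => /eqP.
Qed.

Lemma dual_hom_surj : limg dual_hom = fullv.
Proof.
apply/vspaceP=> t; rewrite memvf.
have : t \in limg quo by rewrite sym_to_T_surj memvf.
case/memv_imgP=> f _ ->.
pose h : sympow k 2 m := \sum_(be : {be : 'X_{1..2 < m.+1} | mdeg (val be) == m})
    (f@_(val (val be) + dd) / dual_coef (val (val be))) *: mono k m (val (val be)).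
suff -> : quo f = dual_hom h by apply/memv_img/memvf.
rewrite dual_homE; apply: eq_sym_to_T => be bem; rewrite mcoeff_dual_fun //.
by rewrite (mcoeff_mono_sum (fun be => f@_(be + dd) / dual_coef be)) // divfK ?dual_coef_neq0.
Qed.

Lemma T_iso_twist : rep_iso (T k 2 l) (tens_rep (Sym k 2 m) (col_rep (det_mxrep k 2 d))).
Proof.
apply: rep_iso_sym; exists twist_map; split; first exact: twist_map_equivariant.
  have line (x : 'cV[k]_1) : exists c, x = c *: const_mx 1.
    by exists (x 0 0); apply/colP=> i; rewrite !mxE mulr1 ord1.
  apply/eqP; rewrite -subv0; apply/subvP=> t; rewrite memv_ker memv0 => /eqP.
  have [f ->] := tens_line line t; rewrite twist_mapE mxE scale1r => /eqP.
  by rewrite -memv_ker dual_hom_inj memv0 => /eqP ->; rewrite tens0l.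
apply/vspaceP=> t; rewrite memvf.
have : t \in limg dual_hom by rewrite dual_hom_surj memvf.
case/memv_imgP=> f _ ->; apply/memv_imgP; exists (tens f (const_mx 1)); first exact: memvf.
by rewrite twist_mapE mxE scale1r.
Qed.

End Duality.

(** * The theorem *)

Section RankTwo.
Variables (k : fieldType) (p : nat) (charkp : p \in [pchar k]).

Lemma T_iso_Sym l : (l < p)%N -> rep_iso (T k 2 l) (Sym k 2 l%:Z).
Proof.
move=> lp; have [] := @koszul_exact k 2 p charkp l 0; first by rewrite mul0n mul1n.
move=> /(_ 0%N isT) qE q0 _ q1; apply: rep_iso_sym; exists (sym_to_T k 2 l).
by split.
Qed.

(** For l > 2(p - 1) one of the two exponents of any monomial is at least p. *)
Lemma T_eq0 l (t : T k 2 l) : (2 * (p - 1) < l)%N -> t = 0.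
Proof.
move=> l_big; have : t \in limg (sym_to_T k 2 l) by rewrite sym_to_T_surj memvf.
case/memv_imgP=> f _ ->; rewrite (mono_expand f) linear_sum; apply: big1 => i _.
set al := val (val i); have all : mdeg al = l := eqP (valP i).
have [j pj] : exists j, (p <= al j)%N.
  have := all; rewrite mdeg2 => E.
  by have [|p0] := leqP p (al ord0); [exists ord0|exists ord_max; lia].
by rewrite linearZ /= (sym_to_T_large charkp all pj) scaler0.
Qed.

Lemma T_iso_zero l (W : rep k 2) : (2 * (p - 1) < l)%N -> (forall w : W, w = 0) ->
  rep_iso (T k 2 l) W.
Proof.
move=> l_big W0; exists 0; split=> [g _||].
- by apply/lfunP=> t; apply: etrans (W0 _) (esym (W0 _)).
- by apply/vspaceP=> t; rewrite (T_eq0 t l_big) !mem0v.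
by apply/vspaceP=> w; rewrite (W0 w) !mem0v.
Qed.

Lemma T_iso_high l : (p <= l)%N ->
  rep_iso (T k 2 l) (tens_rep (Sym k 2 ((2 * (p - 1))%N%:Z - l%:Z))
                              (col_rep (det_mxrep k 2 (l - (p - 1))))).
Proof.
move=> pl; have p1 := prime_gt1 (pcharf_prime charkp).
have [ll|ll] := leqP l (2 * (p - 1)).
  have -> : (2 * (p - 1))%N%:Z - l%:Z = (2 * (p - 1) - l)%N%:Z by rewrite subzn.
  by apply: (T_iso_twist charkp); lia.
case E : (_ - _) => [m|m]; first by lia.
apply: T_iso_zero => //; apply: tens_ind => [//|s t -> ->|u w]; first by rewrite addr0.
by rewrite (flatmx0 (u : 'cV[k]_0)) tens0l.
Qed.

End RankTwo.

Theorem proposition3p5 (k : closedFieldType) (p : nat) (charkp : p \in [pchar k]) :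
  (forall l : nat,
     rep_iso (T k 2 l)
       (if (l < p)%N then Sym k 2 l%:Z
        else tens_rep (Sym k 2 ((2 * (p - 1))%N%:Z - l%:Z))
                      (col_rep (det_mxrep k 2 (l - (p - 1))%N))))
  /\
  (forall n l lp : nat,
     0 <= l%:Z - lp%:Z * p%:Z < p%:Z ->
     exact_sequence (koszul_seq n charkp l) (koszul_map n charkp l) lp).
Proof.
split=> [l|n l lp lpl].
  case: ltnP => [lp|pl]; first exact: (T_iso_Sym charkp).
  exact: (T_iso_high charkp).
by apply: koszul_exact; lia.
Qed.
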